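(* Let $E$ be a Dedekind complete Riesz space with weak order unit, let $T$ be a strictly positive conditional expectation operator on $E$, and let $\mathcal{L}^1(T)$ be the natural domain ($T$-universal completion) of $T$, with $T$ also denoting its extension to $\mathcal{L}^1(T)$. Then $\mathcal{L}^1(T)$ is strongly sequentially complete: for every strong Cauchy sequence $(f_n)_{n\in\mathbb{N}}$ in $\mathcal{L}^1(T)$, i.e. every sequence for which $v_n:=\sup_{i,j\ge n}T|f_i-f_j|$ is eventually defined and $v_n\downarrow 0$, there exists $f\in\mathcal{L}^1(T)$ such that $T|f_n-f|\to 0$ in order as $n\to\infty$.
   Context: All Riesz spaces (vector lattices) are real. A weak order unit of a Riesz space $E$ is an element $e\in E_+$ such that the band generated by $e$ is $E$. For a Dedekind complete Riesz space $E$, $E^u$ denotes its universal completion: the (unique up to isomorphism) universally complete (i.e. Dedekind complete and laterally complete) Riesz space containing $E$ as an order dense Riesz subspace. Conditional expectation operator: a linear map $T:E\to E$ on a Dedekind complete Riesz space $E$ with weak order unit that is a positive, order continuous projection ($T^2=T$), maps weak order units to weak order units, and whose range $R(T)$ is a Dedekind complete Riesz subspace of $E$. $T$ is strictly positive if $v\in E_+$, $v\neq 0$ implies $Tv\neq 0$. Natural domain: let $D_+$ be the set of $f\in E^u_+$ for which there is an increasing net $(f_\alpha)$ in $E_+$ with $f_\alpha\uparrow f$ in $E^u$ and $(Tf_\alpha)$ bounded above in $E^u$; for such $f$ put $Tf:=\sup_\alpha Tf_\alpha\in E^u$ (independent of the choice of net). Then $\mathcal{L}^1(T):=D_+-D_+=\{f\in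 E^u: |f|\in D_+\}$, and $T$ is extended linearly to $\mathcal{L}^1(T)$. It is known that $\mathcal{L}^1(T)$ is a Dedekind complete Riesz space with weak order unit, that its universal completion is $E^u$, that the extended $T$ is the unique extension of $T$ to a conditional expectation operator on $\mathcal{L}^1(T)$, that it is strictly positive, and that $\mathcal{L}^1(T)$ is $T$-universally complete: if $(x_\alpha)$ is an increasing net in $\mathcal{L}^1(T)_+$ with $(Tx_\alpha)$ order bounded in $E^u$, then $(x_\alpha)$ is order convergent in $\mathcal{L}^1(T)$. $R(T)$ denotes the range of the extended operator $T$ on $\mathcal{L}^1(T)$; it is known to be universally complete. The $R(T)$-valued norm on $\mathcal{L}^1(T)$ is $\|f\|_{T,1}:=T|f|$. ''Eventually defined'' means that there is $n_0$ such that for all $n\ge n_0$ the supremum defining $v_n$ exists (in $R(T)$). A net $(x_\alpha)$ in a Dedekind complete Riesz space converges in order to $x$ if it is eventually order bounded and $\limsup_\alpha x_\alpha=\liminf_\alpha x_\alpha=x$; $v_n\downarrow 0$ means that $(v_n)$ is decreasing with infimum $0$. *)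

(* Defs.v *)
From HB Require Import structures.
From mathcomp Require Import all_boot all_order all_algebra.
From mathcomp Require Import boolp classical_sets reals.

Set Implicit Arguments.
Unset Strict Implicit.
Unset Printing Implicit Defensive.

Import Order.TTheory GRing.Theory Num.Theory.

Local Open Scope classical_set_scope.
Local Open Scope ring_scope.

(* The lattice operations are fields of their own: a structure inheriting from
   [Order.Lattice] and [GRing.Lmodule] would lack a join with
   [Num.RealDomain] in the MathComp hierarchy. *)
HB.mixin Record POrderedLmodule_isRiesz (R : numDomainType) E
    of GRing.Lmodule R E & Num.POrderedZmodule E := {
  riesz_join : E -> E -> E;
  riesz_meet : E -> E -> E;
  riesz_leD2r : forall x y z : E, x <= y -> x + z <= y + z;
  riesz_scale_ge0 : forall (a : R) (x : E), 0 <= a -> 0 <= x -> 0 <= a *: x;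
  riesz_leUx : forall x y z : E, (riesz_join x y <= z) = (x <= z) && (y <= z);
  riesz_lexI : forall x y z : E, (z <= riesz_meet x y) = (z <= x) && (z <= y)
}.

#[short(type="rieszSpaceType")]
HB.structure Definition RieszSpace (R : numDomainType) :=
  { E of GRing.Lmodule R E & Num.POrderedZmodule E
       & POrderedLmodule_isRiesz R E }.

Definition directed (I : Type) (le : I -> I -> Prop) : Prop :=
  [/\ inhabited I,
      forall i, le i i,
      forall i j k, le i j -> le j k -> le i k
    & forall i j, exists k, le i k /\ le j k].

(* The order of a subset [A], e.g. a Riesz subspace, in its own right: bounds
   and extrema are taken among the elements of [A].  Such an extremum may
   differ from the one in the ambient space. *)
Section RelativeOrder.
Context {d : Order.disp_t} {P : porderType d}.
Implicit Types A S : set P.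

Definition ubound_in A S : set P := A `&` ubound S.
Definition lbound_in A S : set P := A `&` lbound S.
Definition sup_in A S : set P := ubound_in A S `&` lbound (ubound_in A S).
Definition inf_in A S : set P := lbound_in A S `&` ubound (lbound_in A S).

Definition dedekind_complete A : Prop :=
  forall S, S `<=` A -> S !=set0 -> ubound_in A S !=set0 -> sup_in A S !=set0.

(* [limsup_in] and [liminf_in] are relations because the tails of [x] have
   extrema only eventually, when [x] is eventually bounded.  The choice of
   [i0] is irrelevant since the extrema of the tails are monotone. *)
Section Nets.
Variables (A : set P) (I : Type) (le : I -> I -> Prop) (x : I -> P).

Definition tail (i : I) : set P := [set x j | j in le i].

Definition limsup_in (l : P) : Prop := exists (i0 : I) (s : I -> P),
  (forall i, le i0 i -> sup_in A (tail i) (s i)) /\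
  inf_in A [set s i | i in le i0] l.

Definition liminf_in (l : P) : Prop := exists (i0 : I) (s : I -> P),
  (forall i, le i0 i -> inf_in A (tail i) (s i)) /\
  sup_in A [set s i | i in le i0] l.

Definition order_cvg_in (l : P) : Prop :=
  [/\ forall i, A (x i),
      exists i0, ubound_in A (tail i0) !=set0 /\ lbound_in A (tail i0) !=set0,
      limsup_in l
    & liminf_in l].

End Nets.

Lemma ubound_inT S : ubound_in setT S = ubound S.
Proof. exact: setTI. Qed.

Lemma sup_inT S : sup_in setT S = supremums S.
Proof. by rewrite /sup_in ubound_inT. Qed.

End RelativeOrder.

Section Riesz.
Context {R : realType}.

Definition riesz_abs (E : rieszSpaceType R) (x : E) : E := riesz_join x (- x).

Definition disjoint_elts (E : rieszSpaceType R) (x y : E) : Prop :=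
  riesz_meet (riesz_abs x) (riesz_abs y) = 0.

Definition riesz_subspace (E : rieszSpaceType R) (A : set E) : Prop :=
  [/\ A 0,
      forall (a : R) x y, A x -> A y -> A (a *: x + y),
      forall x y, A x -> A y -> A (riesz_join x y)
    & forall x y, A x -> A y -> A (riesz_meet x y)].

Definition order_ideal (E : rieszSpaceType R) (B : set E) : Prop :=
  [/\ B 0,
      forall (a : R) x y, B x -> B y -> B (a *: x + y)
    & forall x y, B y -> riesz_abs x <= riesz_abs y -> B x].

Definition band (E : rieszSpaceType R) (B : set E) : Prop :=
  order_ideal B /\
  forall (S : set E) (m : E), S `<=` B -> S !=set0 -> supremums S m -> B m.

Definition band_generated (E : rieszSpaceType R) (S : set E) : set E :=
  [set x | forall B : set E, band B -> S `<=` B -> B x].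

Definition weak_order_unit (E : rieszSpaceType R) (e : E) : Prop :=
  0 <= e /\ band_generated [set e] = setT.

Definition laterally_complete (E : rieszSpaceType R) : Prop :=
  forall S : set E, S !=set0 -> (forall x, S x -> 0 <= x) ->
    (forall x y, S x -> S y -> x <> y -> disjoint_elts x y) ->
    supremums S !=set0.

Definition universally_complete (E : rieszSpaceType R) : Prop :=
  dedekind_complete [set: E] /\ laterally_complete E.

(* The inclusion of [E] in its universal completion is an injective Riesz
   homomorphism [iota]. *)
Definition universal_completion (E Eu : rieszSpaceType R)
    (iota : {linear E -> Eu}) : Prop :=
  [/\ universally_complete Eu,
      injective iota,
      forall x y, iota (riesz_join x y) = riesz_join (iota x) (iota y)
    & forall u : Eu, 0 < u -> exists x : E, 0 < x /\ iota x <= u].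

Definition order_continuous (E : rieszSpaceType R) (T : E -> E) : Prop :=
  forall (I : Type) (le : I -> I -> Prop) (x : I -> E) (l : E), directed le ->
    order_cvg_in setT le x l -> order_cvg_in setT le (T \o x) (T l).

Record cond_expectation (E : rieszSpaceType R) (T : {linear E -> E}) : Prop :=
  CondExpectation {
    cond_exp_ge0 : forall x, 0 <= x -> 0 <= T x;
    cond_exp_order_continuous : order_continuous T;
    cond_exp_proj : forall x, T (T x) = T x;
    cond_exp_weak_unit : forall e, weak_order_unit e -> weak_order_unit (T e);
    cond_exp_range_subspace : riesz_subspace (range T);
    cond_exp_range_complete : dedekind_complete (range T)
  }.

Definition strictly_positive (E : rieszSpaceType R) (T : E -> E) : Prop :=
  forall v, 0 <= v -> v <> 0 -> T v <> 0.

Section NaturalDomain.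
Variables (E Eu : rieszSpaceType R) (iota : {linear E -> Eu}).
Variable T : {linear E -> E}.

Definition approximating_net (I : Type) (le : I -> I -> Prop) (x : I -> E)
    (f : Eu) : Prop :=
  [/\ directed le,
      forall i, 0 <= x i,
      forall i j, le i j -> x i <= x j,
      supremums (range (fun i => iota (x i))) f
    & has_ubound (range (fun i => iota (T (x i))))].

Definition natural_domain_pos : set Eu :=
  [set f | 0 <= f /\ exists (I : Type) (le : I -> I -> Prop) (x : I -> E),
    approximating_net le x f].

(* For a conditional expectation [T] the set below is a singleton when [f] is
   in [natural_domain_pos]; elsewhere the value is the dummy [0]. *)
Definition cond_exp_ext_pos (f : Eu) : Eu :=
  xget 0 [set y | exists (I : Type) (le : I -> I -> Prop) (x : I -> E),
    approximating_net le x f /\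
    supremums (range (fun i => iota (T (x i)))) y].

Definition natural_domain : set Eu :=
  [set f | exists g h : Eu,
    [/\ natural_domain_pos g, natural_domain_pos h & f = g - h]].

(* Likewise, the dummy value [0] outside [natural_domain]. *)
Definition cond_exp_ext (f : Eu) : Eu :=
  xget 0 [set y | exists g h : Eu,
    [/\ natural_domain_pos g, natural_domain_pos h, f = g - h
      & y = cond_exp_ext_pos g - cond_exp_ext_pos h]].

Definition cond_exp_range : set Eu := cond_exp_ext @` natural_domain.

Definition norm_T1 (f : Eu) : Eu := cond_exp_ext (riesz_abs f).

Definition strong_cauchy (f : nat -> Eu) : Prop :=
  exists (n0 : nat) (v : nat -> Eu),
  [/\ forall n, (n0 <= n)%N -> sup_in cond_exp_range
        [set y | exists i j : nat,
          [/\ (n <= i)%N, (n <= j)%N & y = norm_T1 (f i - f j)]] (v n),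
      forall m n, (n0 <= m)%N -> (m <= n)%N -> v n <= v m
    & inf_in cond_exp_range [set v n | n in [set n | (n0 <= n)%N]] 0].

End NaturalDomain.

End Riesz.

(* Main.v *)
Require Import Defs.
From mathcomp Require Import all_boot all_order all_algebra.
From mathcomp Require Import boolp classical_sets reals.

(* A strong Cauchy sequence need not have a subsequence with summable
   increments: [v n] may converge to [0] with no uniformity on any band.  The
   indices are therefore randomised.  For [eps > 0] the components of a unit
   [e = T e] on which [n] is the first index with [v n <= eps *: e] lie in the
   range of [T] and split [e]; gluing the [f n] along them gives [h] with
   [T |f m - h| <= v m + eps *: e].  The elements [h k] obtained for
   [eps = 2^-k] satisfy [T |h (k+1) - h k| <= 2 * 2^-k *: e], so the series of
   the positive and negative parts of their increments converge, and
   [lim h k] is the limit of [f].  Both passages to the limit use the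
   [T]-universal completeness of the natural domain, which Markov's inequality
   and lateral completeness provide.  Monotonicity of the glued partial sums
   requires [f n >= 0], so [f^+] and [f^-] are treated separately. *)

Set Implicit Arguments.
Unset Strict Implicit.
Unset Printing Implicit Defensive.

Import Order.TTheory GRing.Theory Num.Theory.

Local Open Scope classical_set_scope.
Local Open Scope ring_scope.

Local Notation "x \vee y" := (riesz_join x y) (at level 48, left associativity).
Local Notation "x \wedge y" := (riesz_meet x y) (at level 48, left associativity).

(** No band projection is ever formed. The projection of [x >= 0] onto the band of a component [p]
    is replaced by the truncations [x \wedge (p *+ k)], taken for all [k]. The averaging identity
    [T (P x) = P (T x)] then shrinks to [tau (x \wedge r) <= tau x \wedge r] for [r] in the range of
    [T], which monotonicity gives at once; this is why the pieces of [e] have to lie in the range.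
    Truncation by disjoint pieces is additive, so a bound valid on each piece becomes a global bound
    without loss. The extension of [T] is handled through the elements of [E] below a given [f], so
    that order density disposes of the choice of nets. *)

Section RieszBasics.
Context {R : realType} {E : rieszSpaceType R}.
Implicit Types (x y z t : E) (a b : R) (n : nat).

(** * Arithmetic of Riesz spaces: positive parts, absolute values, disjointness *)

Lemma riesz_le_add2r z x y : (x + z <= y + z) = (x <= y).
Proof.
apply/idP/idP => [/(riesz_leD2r _ _ (- z))|]; last exact: riesz_leD2r.
by rewrite !addrK.
Qed.

Lemma riesz_le_add2l z x y : (z + x <= z + y) = (x <= y).
Proof. by rewrite ![z + _]addrC riesz_le_add2r. Qed.

Lemma riesz_leD x y z t : x <= y -> z <= t -> x + z <= y + t.
Proof.
move=> xy zt; apply: (@le_trans _ _ (y + z)); first by rewrite riesz_le_add2r.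
by rewrite riesz_le_add2l.
Qed.

Lemma riesz_leBlDr x y z : (x - y <= z) = (x <= z + y).
Proof. by rewrite -[LHS](riesz_le_add2r y) subrK. Qed.

Lemma riesz_leBrDr x y z : (x <= y - z) = (x + z <= y).
Proof. by rewrite -[LHS](riesz_le_add2r z) subrK. Qed.

Lemma riesz_subr_ge0 x y : (0 <= y - x) = (x <= y).
Proof. by rewrite riesz_leBrDr add0r. Qed.

Lemma riesz_le_opp2 x y : (- x <= - y) = (y <= x).
Proof. by rewrite -[LHS](riesz_le_add2r (x + y)) addKr [x + y]addrC addKr. Qed.

Lemma riesz_addr_ge0 x y : 0 <= x -> 0 <= y -> 0 <= x + y.
Proof. by move=> x0 y0; rewrite -[0]addr0; exact: riesz_leD. Qed.

Lemma riesz_ler_wpDr x y : 0 <= y -> x <= x + y.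
Proof. by move=> y0; rewrite -{1}[x]addr0 riesz_le_add2l. Qed.

Lemma riesz_ler_wpDl x y : 0 <= y -> x <= y + x.
Proof. by rewrite addrC; exact: riesz_ler_wpDr. Qed.

Lemma riesz_leUl x y : x <= x \vee y.
Proof. by have := riesz_leUx x y (x \vee y); rewrite lexx => /esym/andP[]. Qed.

Lemma riesz_leUr x y : y <= x \vee y.
Proof. by have := riesz_leUx x y (x \vee y); rewrite lexx => /esym/andP[]. Qed.

Lemma riesz_leIl x y : x \wedge y <= x.
Proof. by have := riesz_lexI x y (x \wedge y); rewrite lexx => /esym/andP[]. Qed.

Lemma riesz_leIr x y : x \wedge y <= y.
Proof. by have := riesz_lexI x y (x \wedge y); rewrite lexx => /esym/andP[]. Qed.

Lemma riesz_join_le x y z : x <= z -> y <= z -> x \vee y <= z.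
Proof. by move=> xz yz; rewrite riesz_leUx xz. Qed.

Lemma riesz_meet_ge x y z : z <= x -> z <= y -> z <= x \wedge y.
Proof. by move=> xz yz; rewrite riesz_lexI xz. Qed.

Lemma riesz_leU2 x y z t : x <= z -> y <= t -> x \vee y <= z \vee t.
Proof.
move=> xz yt; apply: riesz_join_le; first exact: le_trans xz (riesz_leUl _ _).
exact: le_trans yt (riesz_leUr _ _).
Qed.

Lemma riesz_leI2 x y z t : x <= z -> y <= t -> x \wedge y <= z \wedge t.
Proof.
move=> xz yt; apply: riesz_meet_ge; first exact: le_trans (riesz_leIl _ _) xz.
exact: le_trans (riesz_leIr _ _) yt.
Qed.

Lemma riesz_joinC x y : x \vee y = y \vee x.
Proof.
by apply/le_anti/andP; split; apply: riesz_join_le;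
  rewrite ?riesz_leUl ?riesz_leUr.
Qed.

Lemma riesz_meetC x y : x \wedge y = y \wedge x.
Proof.
by apply/le_anti/andP; split; apply: riesz_meet_ge;
  rewrite ?riesz_leIl ?riesz_leIr.
Qed.

Lemma riesz_join_idPr x y : reflect (x \vee y = y) (x <= y).
Proof.
apply: (iffP idP) => [xy|<-]; last exact: riesz_leUl.
by apply/le_anti; rewrite riesz_leUr riesz_join_le.
Qed.

Lemma riesz_meet_idPl x y : reflect (x \wedge y = x) (x <= y).
Proof.
apply: (iffP idP) => [xy|<-]; last exact: riesz_leIr.
by apply/le_anti; rewrite riesz_leIl riesz_meet_ge.
Qed.

Lemma riesz_joinDr x y z : (x \vee y) + z = (x + z) \vee (y + z).
Proof.
apply/le_anti/andP; split; last first.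
  by apply: riesz_join_le; rewrite riesz_le_add2r ?riesz_leUl ?riesz_leUr.
rewrite -riesz_leBrDr; apply: riesz_join_le; rewrite riesz_leBrDr.
  exact: riesz_leUl.
exact: riesz_leUr.
Qed.

Lemma riesz_meetDr x y z : (x \wedge y) + z = (x + z) \wedge (y + z).
Proof.
apply/le_anti/andP; split.
  by apply: riesz_meet_ge; rewrite riesz_le_add2r ?riesz_leIl ?riesz_leIr.
rewrite -riesz_leBlDr; apply: riesz_meet_ge; rewrite riesz_leBlDr.
  exact: riesz_leIl.
exact: riesz_leIr.
Qed.

Lemma riesz_oppU x y : - (x \vee y) = - x \wedge - y.
Proof.
apply/le_anti/andP; split.
  by apply: riesz_meet_ge; rewrite riesz_le_opp2 ?riesz_leUl ?riesz_leUr.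
rewrite -riesz_le_opp2 opprK; apply: riesz_join_le;
  by rewrite -riesz_le_opp2 opprK ?riesz_leIl ?riesz_leIr.
Qed.

Lemma riesz_meetE x y : x \wedge y = x + y - (x \vee y).
Proof.
by rewrite addrC riesz_oppU riesz_meetDr addKr [x + y]addrC addKr riesz_meetC.
Qed.

Definition riesz_pos x : E := x \vee 0.

Lemma riesz_pos_ge0 x : 0 <= riesz_pos x.
Proof. exact: riesz_leUr. Qed.

Lemma riesz_le_pos x : x <= riesz_pos x.
Proof. exact: riesz_leUl. Qed.

Lemma riesz_pos_le x y : x <= y -> 0 <= y -> riesz_pos x <= y.
Proof. exact: riesz_join_le. Qed.

Lemma riesz_pos_mono x y : x <= y -> riesz_pos x <= riesz_pos y.
Proof. by move=> xy; exact: riesz_leU2. Qed.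

Lemma riesz_pos_id x : 0 <= x -> riesz_pos x = x.
Proof. by move=> x0; rewrite /riesz_pos riesz_joinC; exact/riesz_join_idPr. Qed.

(** Truncation plus excess. Whatever lies below the excess can be added to whatever lies below the
    truncation without leaving [x]; the density and Archimedean arguments rest on this. *)
Lemma riesz_posE x y : (x \wedge y) + riesz_pos (x - y) = x.
Proof.
have -> : riesz_pos (x - y) = (x \vee y) - y.
  by rewrite riesz_joinDr subrr.
by rewrite riesz_meetE addrA subrK addrK.
Qed.

Lemma riesz_posBN x : riesz_pos x - riesz_pos (- x) = x.
Proof.
rewrite -{1}[x]subr0 -{3}(riesz_posE x 0) subr0 [RHS]addrC; congr (_ + _).
by rewrite riesz_oppU opprK oppr0.
Qed.

Lemma riesz_meet_ge0 x y : 0 <= x -> 0 <= y -> 0 <= x \wedge y.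
Proof. exact: riesz_meet_ge. Qed.

Lemma riesz_ge0_mulrn x n : 0 <= x -> 0 <= x *+ n.
Proof.
by move=> x0; elim: n => [|n IHn]; rewrite ?mulr0n// mulrS riesz_addr_ge0.
Qed.

Lemma riesz_le_mulrn x y n : x <= y -> x *+ n <= y *+ n.
Proof.
by move=> xy; elim: n => [|n IHn]; rewrite ?mulr0n// !mulrS riesz_leD.
Qed.

Lemma riesz_le_mulrn2 x m n : 0 <= x -> (m <= n)%N -> x *+ m <= x *+ n.
Proof.
by move=> x0 /subnK <-; rewrite mulrnDr riesz_ler_wpDl// riesz_ge0_mulrn.
Qed.

Lemma riesz_sum_ge0 n (F : 'I_n -> E) :
  (forall i, 0 <= F i) -> 0 <= \sum_(i < n) F i.
Proof. by move=> F0; elim/big_ind: _ => // x y; exact: riesz_addr_ge0. Qed.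

Lemma riesz_le_scale a x y : 0 <= a -> x <= y -> a *: x <= a *: y.
Proof.
by move=> a0 xy; rewrite -riesz_subr_ge0 -scalerBr riesz_scale_ge0// riesz_subr_ge0.
Qed.

Lemma riesz_double_ge0 x : 0 <= x + x -> 0 <= x.
Proof.
move=> xx; have := @riesz_scale_ge0 R E 2^-1 _ _ xx.
rewrite -mulr2n -scaler_nat scalerA mulVf ?pnatr_eq0// scale1r; apply.
by rewrite invr_ge0 ler0n.
Qed.

Local Notation abs := riesz_abs.

Lemma riesz_le_abs x : x <= abs x.
Proof. exact: riesz_leUl. Qed.

Lemma riesz_le_absN x : - x <= abs x.
Proof. exact: riesz_leUr. Qed.

Lemma riesz_absP x y : x <= y -> - x <= y -> abs x <= y.
Proof. exact: riesz_join_le. Qed.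

Lemma riesz_abs_ge0 x : 0 <= abs x.
Proof.
by apply: riesz_double_ge0; rewrite -(subrr x) riesz_leD ?riesz_le_abs ?riesz_le_absN.
Qed.

Lemma riesz_abs_id x : 0 <= x -> abs x = x.
Proof.
move=> x0; apply/le_anti/andP; split; last exact: riesz_le_abs.
apply: riesz_absP => //; apply: (le_trans _ x0).
by rewrite -riesz_subr_ge0 opprK add0r.
Qed.

Lemma riesz_absN x : abs (- x) = abs x.
Proof. by rewrite /riesz_abs opprK riesz_joinC. Qed.

Lemma riesz_distC x y : abs (x - y) = abs (y - x).
Proof. by rewrite -riesz_absN opprB. Qed.

Lemma riesz_absD x y : abs (x + y) <= abs x + abs y.
Proof.
apply: riesz_absP; first by rewrite riesz_leD ?riesz_le_abs.
by rewrite opprD riesz_leD ?riesz_le_absN.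
Qed.

Lemma riesz_dist_triangle z x y : abs (x - y) <= abs (x - z) + abs (z - y).
Proof. by rewrite -{1}(subrK z x) -addrA riesz_absD. Qed.

Lemma riesz_pos_le_abs x : riesz_pos x <= abs x.
Proof. exact: riesz_pos_le (riesz_le_abs _) (riesz_abs_ge0 _). Qed.

Lemma riesz_abs_le_pos x : abs x <= riesz_pos x + riesz_pos (- x).
Proof.
apply: riesz_absP.
  exact: le_trans (riesz_le_pos _) (riesz_ler_wpDr _ (riesz_pos_ge0 _)).
exact: le_trans (riesz_le_pos _) (riesz_ler_wpDl _ (riesz_pos_ge0 _)).
Qed.

Lemma riesz_pos_dist x y : abs (riesz_pos x - riesz_pos y) <= abs (x - y).
Proof.
have H u w : riesz_pos u - riesz_pos w <= abs (u - w).
  rewrite riesz_leBlDr; apply: riesz_pos_le.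
    rewrite -[X in X <= _](subrK w).
    exact: riesz_leD (riesz_le_abs _) (riesz_le_pos _).
  exact: riesz_addr_ge0 (riesz_abs_ge0 _) (riesz_pos_ge0 _).
by apply: riesz_absP => //; rewrite opprB riesz_distC.
Qed.

Lemma riesz_meet_leD x y z : 0 <= x -> 0 <= y -> 0 <= z ->
  x \wedge (y + z) <= (x \wedge y) + (x \wedge z).
Proof.
move=> x0 y0 z0; rewrite -riesz_leBlDr.
apply: riesz_meet_ge; rewrite riesz_leBlDr.
  by apply: le_trans (riesz_leIl _ _) (riesz_ler_wpDr _ _); exact: riesz_meet_ge0.
rewrite [leRHS]addrC riesz_meetDr; apply: riesz_meet_ge.
  exact: le_trans (riesz_leIl _ _) (riesz_ler_wpDr _ _).
by rewrite [z + y]addrC; exact: riesz_leIr.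
Qed.

Lemma riesz_disj_mono x y x' y' : 0 <= x' -> 0 <= y' -> x' <= x -> y' <= y ->
  x \wedge y = 0 -> x' \wedge y' = 0.
Proof.
move=> x0 y0 xx yy xy; apply/le_anti/andP; split; last exact: riesz_meet_ge0.
by rewrite -xy; exact: riesz_leI2.
Qed.

Lemma riesz_disjD x y z : 0 <= x -> 0 <= y -> 0 <= z ->
  x \wedge y = 0 -> x \wedge z = 0 -> x \wedge (y + z) = 0.
Proof.
move=> x0 y0 z0 xy xz; apply/le_anti/andP; split.
  by apply: le_trans (riesz_meet_leD x0 y0 z0) _; rewrite xy xz addr0.
by apply: riesz_meet_ge => //; exact: riesz_addr_ge0.
Qed.

Lemma riesz_disj_mulrn x y n : 0 <= x -> 0 <= y ->
  x \wedge y = 0 -> x \wedge (y *+ n) = 0.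
Proof.
move=> x0 y0 xy; elim: n => [|n IHn].
  by rewrite mulr0n riesz_meetC; exact/riesz_meet_idPl.
by rewrite mulrS riesz_disjD// riesz_ge0_mulrn.
Qed.

Lemma riesz_disj_sum x (F : nat -> E) (P : pred nat) n : 0 <= x ->
  (forall i, 0 <= F i) -> (forall i, P i -> x \wedge F i = 0) ->
  x \wedge (\sum_(i < n | P i) F i) = 0.
Proof.
move=> x0 F0 xF.
suff [] : 0 <= \sum_(i < n | P i) F i /\ x \wedge (\sum_(i < n | P i) F i) = 0 by [].
elim/big_ind: _ => [||i Pi].
- by split => //; rewrite riesz_meetC; exact/riesz_meet_idPl.
- move=> y z [y0 xy] [z0 xz]; split; first exact: riesz_addr_ge0.
  exact: riesz_disjD.
- by split => //; exact: xF.
Qed.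

Lemma riesz_disj_joinE x y : x \wedge y = 0 -> x \vee y = x + y.
Proof. by rewrite riesz_meetE => /eqP; rewrite subr_eq0 => /eqP. Qed.

Lemma riesz_meetDE x y z : 0 <= x -> 0 <= y -> 0 <= z -> y \wedge z = 0 ->
  x \wedge (y + z) = (x \wedge y) + (x \wedge z).
Proof.
move=> x0 y0 z0 yz; apply/le_anti/andP; split; first exact: riesz_meet_leD.
apply: riesz_meet_ge; last by rewrite riesz_leD ?riesz_leIr.
rewrite -riesz_disj_joinE; first by apply: riesz_join_le; exact: riesz_leIl.
apply: riesz_disj_mono yz; by [exact: riesz_meet_ge0|exact: riesz_leIr].
Qed.

(** With [t = x \wedge m], every [z] in [S] is disjoint from [t], so [z + t] is the join of [z] and
    [t] and stays below [m]. Hence [m - t] still bounds [S]. *)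
Lemma riesz_disj_sup x (S : set E) m : 0 <= x -> S !=set0 ->
  (forall z, S z -> 0 <= z /\ x \wedge z = 0) -> supremums S m ->
  x \wedge m = 0.
Proof.
move=> x0 [s0 Ss0] xS [Sm mS]; set t := x \wedge m.
have m0 : 0 <= m by apply: le_trans (Sm _ Ss0); have [] := xS _ Ss0.
have t0 : 0 <= t by exact: riesz_meet_ge0.
apply/le_anti/andP; split=> //.
suff : m <= m - t by rewrite riesz_leBrDr -{2}[m]addr0 riesz_le_add2l.
apply: mS => z Sz; have [z0 xz] := xS _ Sz; rewrite riesz_leBrDr.
rewrite -riesz_disj_joinE.
  by apply: riesz_join_le; [exact: Sm|exact: riesz_leIr].
rewrite riesz_meetC; apply: (riesz_disj_mono _ _ _ _ xz) => //.
exact: riesz_leIl.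
Qed.

(** One half of infinite distributivity: each [s] is at most [(x \wedge s) + riesz_pos (s - x)], so
    [u + (m - x)] bounds [S]. *)
Lemma riesz_le_meet_sup x (S : set E) m u : x <= m -> supremums S m ->
  (forall s, S s -> x \wedge s <= u) -> x <= u.
Proof.
move=> xm [Sm mS] Su.
suff : m <= u + (m - x) by rewrite addrCA -{1}[m]addr0 riesz_le_add2l riesz_subr_ge0.
apply: mS => s Ss; rewrite -{1}(riesz_posE s x).
apply: riesz_leD; first by rewrite riesz_meetC; exact: Su.
apply: riesz_pos_le; last by rewrite riesz_subr_ge0.
by rewrite riesz_le_add2r; exact: Sm.
Qed.

Lemma riesz_abs_scale a x : 0 <= a -> abs (a *: x) = a *: abs x.
Proof.
rewrite le_eqVlt => /predU1P[<-|a0]; first by rewrite !scale0r riesz_abs_id.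
have H b y : 0 < b -> abs (b *: y) <= b *: abs y.
  move=> b0; apply: riesz_absP; rewrite -?scalerN; apply: riesz_le_scale;
    by rewrite ?riesz_le_abs ?riesz_le_absN// ltW.
apply/le_anti/andP; split; first exact: H.
have := H a^-1 (a *: x); rewrite invr_gt0 => /(_ a0).
rewrite scalerA mulVf ?gt_eqF// scale1r => /(riesz_le_scale (ltW a0)).
by rewrite scalerA mulfV ?gt_eqF// scale1r.
Qed.

End RieszBasics.

(** * Markov's inequality; suprema and infima of families *)

Section Extrema.
Context {R : realType} {X : rieszSpaceType R}.
Implicit Types (x y z t e : X).

Lemma riesz_disj_scale x y (a : R) : 0 <= a -> 0 <= x -> 0 <= y ->
  x \wedge y = 0 -> x \wedge (a *: y) = 0.
Proof.
move=> a0 x0 y0 xy.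
apply: (@riesz_disj_mono _ _ x (y *+ (Num.bound a))) => //.
- exact: riesz_scale_ge0.
- rewrite -scaler_nat -riesz_subr_ge0 -scalerBl riesz_scale_ge0// subr_ge0 ltW//.
  by have := archi_boundP a0.
- exact: riesz_disj_mulrn.
Qed.

Lemma riesz_disj_pos x : riesz_pos x \wedge riesz_pos (- x) = 0.
Proof.
have -> : riesz_pos (- x) = riesz_pos x - x.
  by rewrite -{3}(riesz_posBN x) opprB addrC subrK.
rewrite -{1}[riesz_pos x]add0r [riesz_pos x - x]addrC -riesz_meetDr.
rewrite -{1}oppr0 -riesz_oppU riesz_joinC; exact: addNr.
Qed.

(** As [n] grows, the meet increases to the component of [e] on which [y] exceeds [a *: e]. The
    excess [d] of [a *: z] over [y] lies below [riesz_pos (a *: e - y)], hence is disjoint from [w]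
    and from [a *: z]; but [d <= a *: z], so [d] vanishes. *)
Lemma riesz_markov e y (a : R) n : 0 <= a -> 0 <= e -> 0 <= y ->
  a *: (e \wedge (riesz_pos (y - a *: e) *+ n)) <= y.
Proof.
move=> a0 e0 y0; set w := riesz_pos _; set z := _ \wedge _.
have w0 : 0 <= w := riesz_pos_ge0 _.
have z0 : 0 <= z by apply: riesz_meet_ge0 => //; exact: riesz_ge0_mulrn.
have az0 : 0 <= a *: z by exact: riesz_scale_ge0.
set d := riesz_pos (a *: z - y); have d0 : 0 <= d := riesz_pos_ge0 _.
have dw : d \wedge w = 0.
  rewrite riesz_meetC.
  apply: (riesz_disj_mono _ _ (lexx w) _ (riesz_disj_pos (y - a *: e))) => //.
  rewrite opprB; apply: riesz_pos_mono; rewrite riesz_le_add2r.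
  by apply: riesz_le_scale => //; exact: riesz_leIl.
have dz : d \wedge (a *: z) = 0.
  apply: riesz_disj_scale => //; apply: (@riesz_disj_mono _ _ d (w *+ n)) => //.
    exact: riesz_leIr.
  exact: riesz_disj_mulrn.
have : d = 0.
  rewrite -dz; apply/esym/riesz_meet_idPl; apply: riesz_pos_le => //.
  by rewrite riesz_leBlDr riesz_ler_wpDr.
move=> dE; have := riesz_le_pos (a *: z - y).
by rewrite -/d dE riesz_leBlDr add0r.
Qed.

Definition is_sup (I : Type) (y : I -> X) (m : X) : Prop :=
  (forall i, y i <= m) /\ (forall u, (forall i, y i <= u) -> m <= u).

Definition is_inf (I : Type) (y : I -> X) (m : X) : Prop :=
  (forall i, m <= y i) /\ (forall u, (forall i, u <= y i) -> u <= m).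

Lemma is_supP (I : Type) (y : I -> X) m :
  supremums (range y) m <-> is_sup y m.
Proof.
split=> [[ym my]|[ym my]]; split.
- by move=> i; apply: ym; exists i.
- by move=> u yu; apply: my => _ [i _ <-].
- by move=> _ [i _ <-].
- by move=> u yu; apply: my => i; apply: yu; exists i.
Qed.

Lemma is_inf_BlDl (I : Type) (y : I -> X) m x :
  is_inf y m -> is_sup (fun i => x - y i) (x - m).
Proof.
move=> [my ym]; split=> [i|u yu]; first by rewrite riesz_le_add2l riesz_le_opp2.
rewrite riesz_leBlDr addrC -riesz_leBlDr; apply: ym => i.
by rewrite riesz_leBlDr addrC -riesz_leBlDr.
Qed.

Lemma is_sup_addr (I : Type) (y : I -> X) m x :
  is_sup y m -> is_sup (fun i => y i + x) (m + x).
Proof.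
move=> [ym my]; split=> [i|u yu]; first by rewrite riesz_le_add2r.
by rewrite -riesz_leBrDr; apply: my => i; rewrite riesz_leBrDr.
Qed.

Lemma is_sup_meet (I : Type) (y : I -> X) m x : x <= m -> is_sup y m ->
  is_sup (fun i => x \wedge y i) x.
Proof.
move=> xm ym; split=> [i|u yu]; first exact: riesz_leIl.
apply: (riesz_le_meet_sup xm); first exact/is_supP/ym.
by move=> _ [i _ <-].
Qed.

Lemma riesz_nondecreasing (y : nat -> X) : (forall n, y n <= y n.+1) ->
  forall m n, (m <= n)%N -> y m <= y n.
Proof.
move=> yS m n /subnK <-; elim: (n - m)%N => [|k IHk] //.
by rewrite addSn; exact: le_trans IHk _.
Qed.

Lemma riesz_nonincreasing (y : nat -> X) : (forall n, y n.+1 <= y n) ->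
  forall m n, (m <= n)%N -> y n <= y m.
Proof.
move=> yS m n mn; rewrite -riesz_le_opp2.
by apply: (@riesz_nondecreasing (fun n => - y n)) => // k; rewrite riesz_le_opp2.
Qed.

End Extrema.

(** * Weak order units as elements disjoint from nothing but zero *)

Section WeakUnit.
Context {R : realType} {X : rieszSpaceType R}.
Implicit Types (x y z t e : X).

Lemma disjoint_complement_band x : 0 <= x ->
  band [set y : X | riesz_abs y \wedge x = 0].
Proof.
move=> x0; split; [split=> /=|].
- by rewrite riesz_abs_id//; exact/riesz_meet_idPl.
- move=> a y z yx zx.
  have abs0 (u : X) := riesz_abs_ge0 u.
  rewrite riesz_meetC in yx; rewrite riesz_meetC in zx.
  rewrite riesz_meetC.
  have H : x \wedge (`|a| *: riesz_abs y + riesz_abs z) = 0.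
    apply: riesz_disjD => //; first exact: riesz_scale_ge0.
    exact: riesz_disj_scale.
  apply: (riesz_disj_mono _ _ (lexx x) _ H) => //.
  apply: (le_trans (riesz_absD _ _)); rewrite riesz_le_add2r.
  rewrite -riesz_abs_scale//; have [a0|a0] := leP 0 a.
    by rewrite ger0_norm.
  by rewrite ltr0_norm// scaleNr riesz_absN.
- move=> y z zx yz; apply: (riesz_disj_mono _ _ yz (lexx x) zx) => //.
  exact: riesz_abs_ge0.
- move=> S m SB [s0 Ss0] [Sm mS] /=; rewrite riesz_meetC.
  (* [S] may contain elements of any sign: the positive part of [m] is the supremum of the positive
     parts over [S], while its negative part is dominated by that of the single element [s0]. *)
  have H : x \wedge (riesz_pos m + riesz_pos (- s0)) = 0.
    apply: riesz_disjD => //; try exact: riesz_pos_ge0.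
      apply: (@riesz_disj_sup _ _ _ (riesz_pos @` S)) => //.
      - by exists (riesz_pos s0), s0.
      - move=> _ [s Ss <-]; split; first exact: riesz_pos_ge0.
        rewrite riesz_meetC.
        apply: riesz_disj_mono (SB _ Ss) => //; first exact: riesz_pos_ge0.
        exact: riesz_pos_le_abs.
      - split=> [_ [s Ss <-]|u Su]; first by apply: riesz_pos_mono; exact: Sm.
        apply: riesz_pos_le; last by apply: le_trans (Su _ _); [exact: riesz_pos_ge0|exists s0].
        apply: mS => s Ss; apply: le_trans (riesz_le_pos s) _.
        by apply: Su; exists s.
    rewrite riesz_meetC; apply: riesz_disj_mono (SB _ Ss0) => //.
      exact: riesz_pos_ge0.
    by rewrite -riesz_absN; exact: riesz_pos_le_abs.
  apply: (riesz_disj_mono _ _ (lexx x) _ H) => //; first exact: riesz_abs_ge0.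
  apply: (le_trans (riesz_abs_le_pos _)); rewrite riesz_le_add2l.
  by apply: riesz_pos_mono; rewrite riesz_le_opp2; exact: Sm.
Qed.

(** The form in which units are used: it proves that an element vanishes, and it passes to the
    completion by order density. *)
Definition disjointness_unit e : Prop :=
  0 <= e /\ forall t, 0 <= t -> t \wedge e = 0 -> t = 0.

Lemma weak_order_unit_disjointness e :
  weak_order_unit e -> disjointness_unit e.
Proof.
move=> [e0 eT]; split=> // t t0 te.
have : band_generated [set e] t by rewrite eT.
move=> /(_ _ (disjoint_complement_band t0)) /=.
rewrite riesz_abs_id// => H; apply: (etrans _ (H _)).
  exact/esym/riesz_meet_idPl.
by move=> _ ->; rewrite /= riesz_abs_id// riesz_meetC.
Qed.

End WeakUnit.

(** * Components of a unit, their pieces, and bounds from lateral completeness *)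

Section DedekindComplete.
Context {R : realType} {X : rieszSpaceType R}.
Hypothesis hX : dedekind_complete [set: X].
Implicit Types (x y z t e : X).

Lemma sup_exists (I : Type) (y : I -> X) (i0 : I) u :
  (forall i, y i <= u) -> exists m, is_sup y m.
Proof.
move=> yu; have [||m] := hX (@subsetT _ (range y)).
- by exists (y i0), i0.
- by exists u; split=> // _ [i _ <-].
by rewrite sup_inT => /is_supP; exists m.
Qed.

Lemma inf_exists (I : Type) (y : I -> X) (i0 : I) u :
  (forall i, u <= y i) -> exists m, is_inf y m.
Proof.
move=> uy; have [|m [ym my]] := @sup_exists _ (fun i => - y i) i0 (- u).
  by move=> i; rewrite riesz_le_opp2.
exists (- m); split=> [i|v vy]; first by rewrite -riesz_le_opp2 opprK.
by rewrite -riesz_le_opp2 opprK; apply: my => i; rewrite riesz_le_opp2.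
Qed.

(** A supremum [m] of the multiples of [t] would make [m - t] an upper bound as well. *)
Lemma riesz_archimedean x t : (forall n, t *+ n <= x) -> t <= 0.
Proof.
move=> tx; have [m [tm mt]] := sup_exists 0%N tx.
suff : m <= m - t by rewrite riesz_leBrDr -{2}[m]addr0 riesz_le_add2l.
by apply: mt => n; rewrite riesz_leBrDr -mulrSr.
Qed.

(** The hypothesis says that [s] dominates the projection of [x] onto the band of [c]. If [t] is the
    meet in question, then [t *+ n <= x] implies [t *+ n <= x \wedge (c *+ n) <= s], and adding [t],
    which is below the excess of [x] over [s], gives [t *+ n.+1 <= x]; so [t] is zero. *)
Lemma riesz_disj_posB x c s : 0 <= x -> 0 <= c ->
  (forall n, x \wedge (c *+ n) <= s) -> riesz_pos (x - s) \wedge c = 0.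
Proof.
move=> x0 c0 xs; apply/le_anti/andP; split; last first.
  by apply: riesz_meet_ge0 => //; exact: riesz_pos_ge0.
set t := _ \wedge _; apply: (@riesz_archimedean x).
elim=> [|n IHn]; first by rewrite mulr0n.
rewrite mulrSr -[leRHS](riesz_posE x s); apply: riesz_leD.
  apply: riesz_meet_ge => //; apply: le_trans (xs n).
  apply: riesz_meet_ge => //; apply: riesz_le_mulrn; exact: riesz_leIr.
exact: riesz_leIl.
Qed.

(* [q] is the component of [e] in the band generated by the [w n]. *)
Lemma component_sup e (w : nat -> X) q : 0 <= e -> (forall n, 0 <= w n) ->
  (forall n, w n <= w n.+1) -> is_sup (fun n => e \wedge (w n *+ n.+1)) q ->
  [/\ 0 <= q, q <= e, forall n, (e - q) \wedge w n = 0
    & (e - q) \wedge q = 0].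
Proof.
move=> e0 w0 wS qsup; have [wq qw] := qsup.
have q0 : 0 <= q.
  by apply: le_trans (wq 0%N); apply: riesz_meet_ge0 => //; exact: w0.
have qe : q <= e by apply: qw => n; exact: riesz_leIl.
have eq0 : 0 <= e - q by rewrite riesz_subr_ge0.
have eqw n : (e - q) \wedge w n = 0.
  rewrite -(riesz_pos_id eq0); apply: riesz_disj_posB => // k.
  (* The supremum is diagonal: its index drives both [w] and the multiple, and [maxn n k] is large
     enough for each. *)
  apply: le_trans (wq (maxn n k)); apply: riesz_leI2 => //.
  apply: (@le_trans _ _ (w (maxn n k) *+ k)).
    by apply: riesz_le_mulrn; apply: riesz_nondecreasing => //; exact: leq_maxl.
  by apply: riesz_le_mulrn2 => //; rewrite leqW// leq_maxr.
split=> //; apply: (@riesz_disj_sup _ _ _ (range (fun n => e \wedge (w n *+ n.+1)))) => //.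
- by exists (e \wedge (w 0%N *+ 1)), 0%N.
- move=> _ [n _ <-]; have wn0 := riesz_ge0_mulrn n.+1 (w0 n).
  split; first exact: riesz_meet_ge0.
  apply: (@riesz_disj_mono _ _ (e - q) (w n *+ n.+1)) => //.
  + exact: riesz_meet_ge0.
  + exact: riesz_leIr.
  + exact: riesz_disj_mulrn.
- exact/is_supP.
Qed.

Section Pieces.
Variables (e : X) (q : nat -> X).
Hypotheses (he : disjointness_unit e) (q0 : forall n, 0 <= q n).
Hypotheses (qe : forall n, q n <= e) (qd : forall n, q n.+1 <= q n).
Hypotheses (qc : forall n, (e - q n) \wedge q n = 0) (qinf : is_inf q 0).

(** When [q n] is the part of [e] not yet stopped after index [n], [piece n] is the part stopped
    exactly at [n]. Before index [0] nothing is stopped, hence [e] in place of a predecessor. *)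
Definition piece n : X := (if n is m.+1 then q m else e) - q n.

Lemma piece_ge0 n : 0 <= piece n.
Proof. by case: n => [|n]; rewrite riesz_subr_ge0. Qed.

Lemma piece_le n : piece n <= e - q n.
Proof. by case: n => [|n] //; rewrite riesz_le_add2r. Qed.

Lemma piece_disj_q n : piece n \wedge q n = 0.
Proof.
apply: riesz_disj_mono (qc n) => //; [exact: piece_ge0|exact: piece_le].
Qed.

Lemma piece_disj i j : (i != j)%N -> piece i \wedge piece j = 0.
Proof.
have H m n : (m < n)%N -> piece m \wedge piece n = 0.
  case: n => // n; rewrite ltnS => mn.
  apply: riesz_disj_mono (piece_disj_q m) => //; try exact: piece_ge0.
  by apply: le_trans (riesz_nonincreasing qd mn); rewrite riesz_leBlDr riesz_ler_wpDr.
rewrite neq_ltn => /orP[/H//|/H]; by rewrite riesz_meetC.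
Qed.

Lemma sum_piece n : \sum_(i < n.+1) piece i = e - q n.
Proof.
elim: n => [|n IHn]; first by rewrite big_ord1.
by rewrite big_ord_recr IHn /= addrA subrK.
Qed.

(** The complement splits into [q n] and what was removed earlier, and the piece is disjoint from
    both. *)
Lemma piece_disj_comp n : piece n \wedge (e - piece n) = 0.
Proof.
have -> : e - piece n = q n + (e - (if n is m.+1 then q m else e)).
  by rewrite /piece opprB addrCA.
have H : 0 <= e - (if n is m.+1 then q m else e) by rewrite riesz_subr_ge0; case: n.
apply: (riesz_disjD (piece_ge0 n) (q0 n) H (piece_disj_q n)).
case: n {H} => [|n].
  by rewrite subrr riesz_meetC; apply/riesz_meet_idPl; exact: piece_ge0.
rewrite riesz_meetC; apply: (riesz_disj_mono _ _ (lexx _) _ (qc n)) => //.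
- by rewrite riesz_subr_ge0.
- exact: (piece_ge0 n.+1).
- by rewrite riesz_leBlDr riesz_ler_wpDr.
Qed.

(** The partial sums of the pieces telescope to [e - q n], which increases to [e]. *)
Lemma disj_pieces t : 0 <= t -> (forall n, t \wedge piece n = 0) -> t = 0.
Proof.
move=> t0 tp; apply: he.2 => //.
apply: (@riesz_disj_sup _ _ _ (range (fun n => e - q n))) => //.
- by exists (e - q 0%N), 0%N.
- move=> _ [n _ <-]; split; first by rewrite riesz_subr_ge0.
  by rewrite -sum_piece; apply: (@riesz_disj_sum _ _ t piece xpredT) => //; exact: piece_ge0.
- by apply/is_supP; rewrite -[X in is_sup _ X]subr0; exact: is_inf_BlDl.
Qed.

End Pieces.

(* The bound is [k *: e] on the part of [e] where [k - 1 < sup_n y n <= k];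
   the parts exhaust [e] because [q] decreases to [0]. *)
Lemma laterally_complete_bound e (y : nat -> X) (q : nat -> X) :
  laterally_complete X -> disjointness_unit e ->
  (forall n, y n <= y n.+1) ->
  (forall k, is_sup (fun n => e \wedge (riesz_pos (y n - e *+ k) *+ n.+1)) (q k)) ->
  is_inf q 0 -> exists b, forall n, y n <= b.
Proof.
move=> hlat he yS qsup qinf; have e0 := he.1.
have wS k n : riesz_pos (y n - e *+ k) <= riesz_pos (y n.+1 - e *+ k).
  by apply: riesz_pos_mono; rewrite riesz_le_add2r.
have qcomp k := component_sup e0 (fun n => riesz_pos_ge0 _) (wS k) (qsup k).
have q0 k : 0 <= q k by case: (qcomp k).
have qe k : q k <= e by case: (qcomp k).
have qc k : (e - q k) \wedge q k = 0 by case: (qcomp k).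
have qw k n : (e - q k) \wedge riesz_pos (y n - e *+ k) = 0 by case: (qcomp k).
have qd k : q k.+1 <= q k.
  apply: (qsup k.+1).2 => n; apply: le_trans ((qsup k).1 n).
  apply: riesz_leI2 => //; apply: riesz_le_mulrn; apply: riesz_pos_mono.
  by rewrite riesz_le_add2l riesz_le_opp2 riesz_le_mulrn2.
pose p := piece e q.
have p0 k : 0 <= p k := piece_ge0 qe qd k.
have pk0 k : 0 <= p k *+ k := riesz_ge0_mulrn k (p0 k).
(* The only appeal to lateral completeness: the disjoint elements [p k *+ k] have a supremum [b]. *)
have [|||b /is_supP [pb _]] := hlat (range (fun k => p k *+ k)).
- by exists (p 0%N *+ 0), 0%N.
- by move=> _ [k _ <-].
- move=> _ _ [i _ <-] [j _ <-] ij; rewrite /disjoint_elts !riesz_abs_id//.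
  have {}ij : (i != j)%N by apply: contra_not_neq ij => ->.
  apply: riesz_disj_mulrn => //; rewrite riesz_meetC.
  apply: riesz_disj_mulrn => //; apply: piece_disj => //.
  by rewrite eq_sym.
exists b => n; suff r0 : riesz_pos (y n - b) = 0.
  by have := riesz_le_pos (y n - b); rewrite r0 riesz_leBlDr add0r.
apply: (disj_pieces (e := e) (q := q)) => //; first exact: riesz_pos_ge0.
move=> k; rewrite riesz_meetC -/p.
have epk0 : 0 <= e - p k.
  rewrite riesz_subr_ge0; apply: le_trans (piece_le qe k) _.
  by rewrite riesz_leBlDr riesz_ler_wpDr.
(* Since [b] dominates [p k *+ k], the excess of [y n] over [b] is below [riesz_pos (y n - e *+ k) +
   (e - p k) *+ k]; both summands are disjoint from [p k]. *)
apply: (@riesz_disj_mono _ _ (p k)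
  (riesz_pos (y n - e *+ k) + (e - p k) *+ k)) => //; first exact: riesz_pos_ge0.
  apply: riesz_pos_le; last first.
    by apply: riesz_addr_ge0; [exact: riesz_pos_ge0|exact: riesz_ge0_mulrn].
  apply: (@le_trans _ _ (y n - p k *+ k)); first by rewrite riesz_le_add2l riesz_le_opp2.
  rewrite [(e - p k) *+ k]mulrnBl addrA riesz_le_add2r -riesz_leBlDr; exact: riesz_le_pos.
apply: riesz_disjD => //; try exact: riesz_pos_ge0.
- exact: riesz_ge0_mulrn.
- apply: riesz_disj_mono (qw k n) => //; [exact: riesz_pos_ge0|exact: piece_le].
- by apply: riesz_disj_mulrn => //; exact: piece_disj_comp.
Qed.

End DedekindComplete.

(** * The extended operator, computed from elements of [E] below its argument *)

Section Extension.
Context {R : realType} {E Eu : rieszSpaceType R}.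
Context {iota : {linear E -> Eu}} {T : {linear E -> E}}.
Hypotheses (hEu : universal_completion iota) (hT : cond_expectation T).

Local Notation D := (natural_domain_pos iota T).
Local Notation tau := (cond_exp_ext_pos iota T).

Implicit Types (S : set E) (f g u b : Eu) (x y : E).

Lemma completion_dedekind : dedekind_complete [set: Eu].
Proof. by case: hEu => -[]. Qed.

Lemma completion_dense u : 0 < u -> exists x, 0 < x /\ iota x <= u.
Proof. by case: hEu => _ _ _; exact. Qed.

Lemma iota_le x y : (iota x <= iota y) = (x <= y).
Proof.
case: hEu => _ inj iU _; apply/riesz_join_idPr/riesz_join_idPr => [|<-].
  by rewrite -iU => /inj.
by rewrite iU; apply/riesz_join_idPr; exact: riesz_leUl.
Qed.

Lemma iota_ge0 x : (0 <= iota x) = (0 <= x).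
Proof. by rewrite -iota_le linear0. Qed.

Lemma iota_meet x y : iota (x \wedge y) = iota x \wedge iota y.
Proof. by case: hEu => _ _ iU _; rewrite !riesz_meetE linearB linearD iU. Qed.

Lemma not_le_pos_gt0 f u : ~~ (f <= u) -> 0 < riesz_pos (f - u).
Proof.
move=> fu; rewrite lt_neqAle riesz_pos_ge0 andbT.
apply: contra fu => /eqP r0; have := riesz_le_pos (f - u).
by rewrite -r0 riesz_leBlDr add0r.
Qed.

(** Suprema of [E] survive in [Eu]: otherwise order density puts some [y > 0] of [E] below the
    excess of [iota m] over [b], and [m - y] already bounds [S]. *)
Lemma iota_sup_le S m b : supremums S m ->
  (forall s, S s -> iota s <= b) -> iota m <= b.
Proof.
move=> [Sm mS] Sb; apply/contraT => /not_le_pos_gt0 /completion_dense[y [y0 yb]].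
suff : m <= m - y.
  by rewrite riesz_leBrDr -{2}[m]addr0 riesz_le_add2l => /(lt_le_trans y0); rewrite ltxx.
apply: mS => s Ss; rewrite riesz_leBrDr -iota_le linearD -(riesz_posE (iota m) b).
by apply: riesz_leD => //; apply: riesz_meet_ge; [rewrite iota_le; exact: Sm|exact: Sb].
Qed.

Lemma cond_exp_mono x y : x <= y -> T x <= T y.
Proof.
move=> xy; rewrite -riesz_subr_ge0 -linearB; apply: cond_exp_ge0 => //.
by rewrite riesz_subr_ge0.
Qed.

Definition upward_directed S : Prop :=
  S !=set0 /\ forall x y, S x -> S y -> exists z, [/\ S z, x <= z & y <= z].

(** A directed set indexed by itself is a net converging in order to its supremum. Order continuity
    makes [T m] the lower limit of the image net, and every infimum of a tail of that net is below
    some [T s]. *)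
Lemma cond_exp_sup_le S m (b : E) : upward_directed S -> supremums S m ->
  (forall s, S s -> T s <= b) -> T m <= b.
Proof.
move=> [[s0 Ss0] Sdir] [Sm mS] Sb.
pose I := {s : E | S s}; pose le (i j : I) := sval i <= sval j.
have ledir : directed le.
  split; first by apply: inhabits; exists s0.
  - by move=> i; exact: lexx.
  - by move=> i j k; exact: le_trans.
  - move=> [x Sx] [y Sy]; have [z [Sz xz yz]] := Sdir _ _ Sx Sy.
    by exists (exist _ z Sz).
have cvg : order_cvg_in setT le (fun i => sval i) m.
  split=> //.
  - exists (exist _ s0 Ss0); split; [exists m|exists s0]; split=> //.
      by move=> _ [i _ <-]; apply: Sm; exact: svalP.
    by move=> _ [i li <-]; exact: li.
  - exists (exist _ s0 Ss0), (fun=> m); split; last first.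
      split; first by split=> // _ [i _ <-].
      by move=> u [_ um]; apply: um; exists (exist _ s0 Ss0) => //; exact: lexx.
    move=> i _; split; first by split=> // _ [j _ <-]; apply: Sm; exact: svalP.
    move=> u [_ tu]; apply: mS => s Ss.
    have [z [Sz sz iz]] := Sdir _ _ Ss (svalP i).
    by apply: (le_trans sz); apply: tu; exists (exist _ z Sz).
  - exists (exist _ s0 Ss0), (fun i => sval i); split.
      move=> i _; split; first by split=> // _ [j ij <-].
      by move=> u [_ ui]; apply: ui; exists i => //; exact: lexx.
    split; first by split=> // _ [i _ <-]; apply: Sm; exact: svalP.
    move=> u [_ tu]; apply: mS => s Ss.
    have [z [Sz sz s0z]] := Sdir _ _ Ss Ss0.
    by apply: (le_trans sz); apply: tu; exists (exist _ z Sz).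
have [_ _ _ [i0 [s [si [_ lub]]]]] := cond_exp_order_continuous hT ledir cvg.
apply: lub; split=> // _ [i i0i <-].
have [[_ sl] _] := si _ i0i; apply: le_trans (Sb _ (svalP i)).
by apply: sl; exists i => //; exact: lexx.
Qed.

(** The largest approximating family of [f]; it takes the place of the arbitrary nets in the
    definition of the natural domain. *)
Definition below f : set E := [set x | 0 <= x /\ iota x <= f].

Lemma below0 f : 0 <= f -> below f 0.
Proof. by move=> f0; split; rewrite ?linear0. Qed.

Lemma below_directed f : 0 <= f -> upward_directed (below f).
Proof.
move=> f0; split; first by exists 0; exact: below0.
move=> x y [x0 xf] [y0 yf]; exists (x \vee y).
case: hEu => _ _ iU _; split; [|exact: riesz_leUl|exact: riesz_leUr].
by split; [exact: le_trans x0 (riesz_leUl _ _)|rewrite iU riesz_join_le].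
Qed.

(** If [f] were not below [u], some [x > 0] of [E] would lie under the excess. Inductively [x *+ n]
    is below [f], hence below [u], and the excess leaves room for one more [x]; this contradicts the
    Archimedean property. *)
Lemma below_le f u : 0 <= f -> (forall x, below f x -> iota x <= u) -> f <= u.
Proof.
move=> f0 fu; apply/contraT => /not_le_pos_gt0 /completion_dense[x [x0 xb]].
suff : iota x <= 0 by rewrite -(linear0 iota) iota_le => /(lt_le_trans x0); rewrite ltxx.
apply: (riesz_archimedean completion_dedekind (x := f)) => n; rewrite -linearMn.
elim: n => [|n IHn]; first by rewrite mulr0n linear0.
rewrite mulrSr linearD -(riesz_posE f u); apply: riesz_leD => //.
by apply: riesz_meet_ge => //; apply: fu; split=> //; rewrite riesz_ge0_mulrn// ltW.
Qed.

(* Independence of the approximating family: [x] is the supremum of the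
   [x \wedge s], to which the order continuity of [T] applies. *)
Lemma cond_exp_below_le S f b x : upward_directed S ->
  supremums (iota @` S) f -> (forall s, S s -> iota (T s) <= b) ->
  below f x -> iota (T x) <= b.
Proof.
move=> [[s0 Ss0] Sdir] Sf Sb [x0 xf].
pose S' := [set x \wedge s | s in S].
have S'x : supremums S' x.
  split; first by move=> _ [s _ <-]; exact: riesz_leIl.
  move=> u xu; rewrite -iota_le; apply: (riesz_le_meet_sup xf Sf) => _ [s Ss <-].
  by rewrite -iota_meet iota_le; apply: xu; exists s.
have S'dir : upward_directed S'.
  split; first by exists (x \wedge s0), s0.
  move=> _ _ [s Ss <-] [t St <-]; have [z [Sz sz tz]] := Sdir _ _ Ss St.
  by exists (x \wedge z); split; [exists z|exact: riesz_leI2|exact: riesz_leI2].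
apply: (@iota_sup_le (T @` S')) => [|_ [_ [s Ss <-] <-]].
  split.
    move=> _ [s S's <-]; apply: cond_exp_mono.
    by case: S'x => + _; apply.
  by move=> u Tu; apply: (cond_exp_sup_le S'dir S'x) => s S's; apply: Tu; exists s.
apply: le_trans (Sb _ Ss); rewrite iota_le; apply: cond_exp_mono; exact: riesz_leIr.
Qed.

Lemma approximating_below f b : 0 <= f ->
  (forall x, below f x -> iota (T x) <= b) ->
  exists (I : Type) (le : I -> I -> Prop) (x : I -> E),
    approximating_net iota T le x f /\ range x = below f.
Proof.
move=> f0 fb; exists {x : E | below f x}, (fun i j => sval i <= sval j).
have [_ bdir] := below_directed f0.
have rE : range (fun i : {x : E | below f x} => sval i) = below f.
  apply/seteqP; split=> [_ [[x fx] _ <-]|x fx] //.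
  by exists (exist _ x fx).
exists (fun i => sval i); split=> //; split.
- split; first by apply: inhabits; exists 0; exact: below0.
  + by move=> i; exact: lexx.
  + by move=> i j k; exact: le_trans.
  + move=> [x fx] [y fy]; have [z [fz xz yz]] := bdir _ _ fx fy.
    by exists (exist _ z fz).
- by move=> [x []].
- by [].
- apply/is_supP; split=> [[x []]|u fu] //; apply: below_le => // x fx.
  exact: (fu (exist _ x fx)).
- by exists b => _ [[x fx] _ <-]; exact: fb.
Qed.

Lemma approximating_directed (I : Type) (le : I -> I -> Prop) (x : I -> E) f :
  approximating_net iota T le x f -> upward_directed (range x).
Proof.
move=> [[[i0] _ _ ledir] _ xmono _ _]; split; first by exists (x i0), i0.
move=> _ _ [i _ <-] [j _ <-]; have [k [ik jk]] := ledir i j.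
by exists (x k); split; [exists k|exact: xmono|exact: xmono].
Qed.

Lemma natural_domain_posP f :
  D f <-> 0 <= f /\ exists b, forall x, below f x -> iota (T x) <= b.
Proof.
split=> [[f0 [I [le [x net]]]]|[f0 [b fb]]]; split=> //; last first.
  have [I [le [x [net _]]]] := approximating_below f0 fb.
  by exists I, le, x.
have xdir := approximating_directed net.
case: net => _ x0 _ xf [b Tb]; exists b => y.
apply: (cond_exp_below_le xdir); first by rewrite image_comp.
by move=> _ [i _ <-]; apply: Tb; exists i.
Qed.

Lemma natural_domain_pos_ge0 f : D f -> 0 <= f.
Proof. by case. Qed.

(** Whichever net [xget] has picked, [cond_exp_below_le] compares it with [below f], so the value is
    the supremum over [below f]. *)
Lemma cond_exp_ext_pos_sup f : D f ->
  (forall x, below f x -> iota (T x) <= tau f) /\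
  (forall b, (forall x, below f x -> iota (T x) <= b) -> tau f <= b).
Proof.
move=> /natural_domain_posP[f0 [b fb]].
have : exists y : Eu, exists (I : Type) (le : I -> I -> Prop) (x : I -> E),
    approximating_net iota T le x f /\
    supremums (range (fun i => iota (T (x i)))) y.
  have [I [le [x [net xf]]]] := approximating_below f0 fb.
  have [[i0] _ _ _] : directed le by case: net.
  have [|m mP] := @sup_exists _ _ completion_dedekind _ (fun i => iota (T (x i))) i0 b.
    by move=> i; apply: fb; rewrite -xf; exists i.
  by exists m, I, le, x; split=> //; exact/is_supP.
move=> /(xgetPex 0); rewrite -/(tau f) => -[I [le [x [net /is_supP[xt tx]]]]].
have xdir := approximating_directed net; case: net => _ x0 _ xf _.
split=> [y|u fu].
  apply: (cond_exp_below_le xdir); first by rewrite image_comp.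
  by move=> _ [i _ <-].
apply: tx => i; apply: fu; split=> //; case: xf => + _; apply; by exists i.
Qed.

Lemma cond_exp_below f x : D f -> below f x -> iota (T x) <= tau f.
Proof. by move=> /cond_exp_ext_pos_sup[+ _]; apply. Qed.

Lemma cond_exp_ext_pos_le f b : D f ->
  (forall x, below f x -> iota (T x) <= b) -> tau f <= b.
Proof. by move=> /cond_exp_ext_pos_sup[_]; apply. Qed.

Lemma cond_exp_ext_pos_directed S f b : upward_directed S ->
  (forall s, S s -> 0 <= s) -> supremums (iota @` S) f ->
  (forall s, S s -> iota (T s) <= b) -> D f /\ tau f <= b.
Proof.
move=> Sdir S0 Sf Sb; have fb x := cond_exp_below_le Sdir Sf Sb (x := x).
have Df : D f.
  apply/natural_domain_posP; split; last by exists b.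
  have [s Ss] := Sdir.1; apply: (@le_trans _ _ (iota s)).
    by rewrite iota_ge0 S0.
  by case: Sf => + _; apply; exists s.
by split=> //; exact: cond_exp_ext_pos_le.
Qed.

Lemma cond_exp_ext_posD f g : D f -> D g ->
  D (f + g) /\ tau (f + g) = tau f + tau g.
Proof.
move=> Df Dg; have f0 := natural_domain_pos_ge0 Df.
have g0 := natural_domain_pos_ge0 Dg.
pose S := [set z | exists x y, [/\ below f x, below g y & z = x + y]].
have [||||Dfg le1] := @cond_exp_ext_pos_directed S (f + g) (tau f + tau g).
- split.
    by exists 0, 0, 0; split; [exact: below0|exact: below0|rewrite addr0].
  move=> _ _ [x [y [fx gy ->]]] [x' [y' [fx' gy' ->]]].
  have [z [fz xz xz']] := (below_directed f0).2 _ _ fx fx'.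
  have [w [gw yw yw']] := (below_directed g0).2 _ _ gy gy'.
  by exists (z + w); split; [exists z, w|exact: riesz_leD|exact: riesz_leD].
- by move=> _ [x [y [[x0 _] [y0 _] ->]]]; exact: riesz_addr_ge0.
- split.
    move=> _ [_ [x [y [[x0 xf] [y0 yg] ->]]] <-].
    by rewrite linearD riesz_leD.
  move=> u Su; rewrite -riesz_leBrDr; apply: below_le => // x fx.
  rewrite riesz_leBrDr addrC -riesz_leBrDr; apply: below_le => // y gy.
  rewrite riesz_leBrDr addrC -linearD; apply: Su; exists (x + y) => //.
  by exists x, y.
- move=> _ [x [y [fx gy ->]]]; rewrite !linearD riesz_leD//; exact: cond_exp_below.
split=> //; apply/le_anti; rewrite le1 /= -riesz_leBrDr.
apply: cond_exp_ext_pos_le => // x fx.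
rewrite riesz_leBrDr addrC -riesz_leBrDr; apply: cond_exp_ext_pos_le => // y gy.
rewrite riesz_leBrDr addrC -!linearD; apply: cond_exp_below => //.
case: fx gy => [x0 xf] [y0 yg]; split; first exact: riesz_addr_ge0.
by rewrite linearD riesz_leD.
Qed.

Lemma natural_domain_pos_solid f g : D f -> 0 <= g -> g <= f ->
  D g /\ tau g <= tau f.
Proof.
move=> Df g0 gf.
have H x : below g x -> iota (T x) <= tau f.
  by move=> [x0 xg]; apply: cond_exp_below => //; split=> //; exact: le_trans gf.
have Dg : D g by apply/natural_domain_posP; split=> //; exists (tau f).
by split=> //; exact: cond_exp_ext_pos_le.
Qed.

Lemma cond_exp_ext_pos_ge0 f : D f -> 0 <= tau f.
Proof.
move=> Df; have f0 := natural_domain_pos_ge0 Df.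
by have := cond_exp_below Df (below0 f0); rewrite !linear0.
Qed.

Lemma cond_exp_ext_pos_iota x : 0 <= x ->
  D (iota x) /\ tau (iota x) = iota (T x).
Proof.
move=> x0.
have H y : below (iota x) y -> iota (T y) <= iota (T x).
  by move=> [_]; rewrite !iota_le; exact: cond_exp_mono.
have Dx : D (iota x).
  by apply/natural_domain_posP; rewrite iota_ge0; split=> //; exists (iota (T x)).
split=> //; apply/le_anti; rewrite cond_exp_ext_pos_le//=.
by apply: cond_exp_below.
Qed.

Lemma natural_domain_pos0 : D 0.
Proof. by have [] := cond_exp_ext_pos_iota (lexx 0); rewrite linear0. Qed.

Lemma cond_exp_ext_pos0 : tau 0 = 0.
Proof. by have [_] := cond_exp_ext_pos_iota (lexx 0); rewrite !linear0. Qed.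

Lemma cond_exp_ext_pos_strict f : strictly_positive T ->
  D f -> tau f = 0 -> f = 0.
Proof.
move=> hpos Df tf; apply/eqP/contraT => fn0.
have : 0 < f by rewrite lt_neqAle eq_sym fn0 natural_domain_pos_ge0.
move=> /completion_dense[x [x0 xf]]; case: (hpos x); first exact: ltW.
  by move=> xE; move: x0; rewrite xE ltxx.
apply/le_anti/andP; split; last by apply: cond_exp_ge0 => //; exact: ltW.
rewrite -iota_le linear0 -tf; apply: cond_exp_below => //.
by split=> //; exact: ltW.
Qed.

(** [tau f] is approximated by the images under [T] of the elements below [f], and [T] fixes these
    images. *)
Lemma cond_exp_ext_pos_idem f : D f -> D (tau f) /\ tau (tau f) = tau f.
Proof.
move=> Df; have f0 := natural_domain_pos_ge0 Df.
have [||||Dtf le1] := @cond_exp_ext_pos_directed (T @` below f) (tau f) (tau f).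
- split; first by exists (T 0), 0 => //; exact: below0.
  move=> _ _ [x fx <-] [y fy <-].
  have [z [fz xz yz]] := (below_directed f0).2 _ _ fx fy.
  by exists (T z); split; [exists z|exact: cond_exp_mono|exact: cond_exp_mono].
- by move=> _ [x [x0 _] <-]; exact: cond_exp_ge0.
- split; first by move=> _ [_ [x fx <-] <-]; exact: cond_exp_below.
  move=> u Su; apply: cond_exp_ext_pos_le => // x fx; apply: Su.
  by exists (T x) => //; exists x.
- by move=> _ [x fx <-]; rewrite (cond_exp_proj hT); exact: cond_exp_below.
split=> //; apply/le_anti; rewrite le1 /=; apply: cond_exp_ext_pos_le => // x fx.
rewrite -(cond_exp_proj hT); apply: cond_exp_below => //.
by split; [apply: cond_exp_ge0 => //; case: fx|exact: cond_exp_below].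
Qed.

(** Monotone convergence. An [x] below [f] is the supremum of the directed set of those [z <= x]
    that already lie below some [y n], and [T] is bounded by [b] on that set. *)
Lemma cond_exp_ext_pos_monotone_cvg (y : nat -> Eu) f b :
  (forall n, y n <= y n.+1) -> (forall n, D (y n)) -> is_sup y f ->
  (forall n, tau (y n) <= b) -> D f /\ tau f <= b.
Proof.
move=> yS Dy yf yb.
have y0 n := natural_domain_pos_ge0 (Dy n).
have f0 : 0 <= f by exact: le_trans (y0 0%N) (yf.1 0%N).
have H x : below f x -> iota (T x) <= b.
  move=> [x0 xf].
  pose S := [set z | [/\ 0 <= z, z <= x & exists n, iota z <= y n]].
  apply: (@cond_exp_below_le S (iota x)).
  - split; first by exists 0; split=> //; exists 0%N; rewrite linear0.
    move=> z w [z0 zx [n zn]] [w0 wx [m wm]]; exists (z \vee w).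
    split; [split|exact: riesz_leUl|exact: riesz_leUr].
    + exact: le_trans z0 (riesz_leUl _ _).
    + exact: riesz_join_le.
    + exists (maxn n m); case: hEu => _ _ -> _; apply: riesz_join_le.
        by apply: (le_trans zn); apply: riesz_nondecreasing => //; exact: leq_maxl.
      by apply: (le_trans wm); apply: riesz_nondecreasing => //; exact: leq_maxr.
  - split; first by move=> _ [z [_ zx _] <-]; rewrite iota_le.
    move=> u Su; apply: (is_sup_meet xf yf).2 => n.
    apply: below_le; first by apply: riesz_meet_ge0; rewrite ?iota_ge0.
    move=> z [z0 zxy]; apply: Su; exists z => //; split=> //.
      by rewrite -iota_le; apply: le_trans zxy (riesz_leIl _ _).
    by exists n; apply: le_trans zxy (riesz_leIr _ _).
  - move=> z [z0 zx [n zn]]; apply: le_trans (yb n).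
    by apply: cond_exp_below => //; split.
  - by split.
have Df : D f by apply/natural_domain_posP; split=> //; exists b.
by split=> //; exact: cond_exp_ext_pos_le.
Qed.

End Extension.

(** * The range of the extended operator, and universal completeness *)

Section FixedPoints.
Context {R : realType} {E Eu : rieszSpaceType R}.
Context {iota : {linear E -> Eu}} {T : {linear E -> E}}.
Hypotheses (hEu : universal_completion iota) (hT : cond_expectation T).
Hypothesis hpos : strictly_positive T.

Local Notation D := (natural_domain_pos iota T).
Local Notation tau := (cond_exp_ext_pos iota T).
Local Notation abs := riesz_abs.

Implicit Types (f g h r s u b : Eu).

Lemma natural_domain_posD f g : D f -> D g -> D (f + g).
Proof. by move=> Df Dg; have [] := cond_exp_ext_posD hEu hT Df Dg. Qed.

Lemma cond_exp_ext_posDE f g : D f -> D g -> tau (f + g) = tau f + tau g.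
Proof. by move=> Df Dg; have [] := cond_exp_ext_posD hEu hT Df Dg. Qed.

Lemma natural_domain_posS f g : D f -> 0 <= g -> g <= f -> D g.
Proof. by move=> Df g0 gf; have [] := natural_domain_pos_solid hEu hT Df g0 gf. Qed.

Lemma cond_exp_ext_pos_mono f g : D f -> 0 <= g -> g <= f -> tau g <= tau f.
Proof. by move=> Df g0 gf; have [] := natural_domain_pos_solid hEu hT Df g0 gf. Qed.

Lemma natural_domain_posB f g : D f -> 0 <= g -> g <= f -> D (f - g).
Proof.
move=> Df g0 gf; apply: (natural_domain_posS Df); first by rewrite riesz_subr_ge0.
by rewrite riesz_leBlDr riesz_ler_wpDr.
Qed.

Lemma cond_exp_ext_posB f g : D f -> 0 <= g -> g <= f ->
  tau (f - g) = tau f - tau g.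
Proof.
move=> Df g0 gf; have Dg := natural_domain_posS Df g0 gf.
by rewrite -{2}(subrK g f) [in RHS]cond_exp_ext_posDE ?addrK//; exact: natural_domain_posB.
Qed.

Lemma cond_exp_ext_pos_sum (F : nat -> Eu) n : (forall i, D (F i)) ->
  D (\sum_(i < n) F i) /\ tau (\sum_(i < n) F i) = \sum_(i < n) tau (F i).
Proof.
move=> DF; elim: n => [|n [Dn tn]].
  by rewrite !big_ord0 (cond_exp_ext_pos0 hEu hT); split=> //; exact: natural_domain_pos0.
rewrite !big_ord_recr /=; split; first exact: natural_domain_posD.
by rewrite cond_exp_ext_posDE// tn.
Qed.

Lemma cond_exp_ext_pos_mulrn f n : D f -> D (f *+ n) /\ tau (f *+ n) = tau f *+ n.
Proof.
move=> Df; have [] := @cond_exp_ext_pos_sum (fun=> f) n (fun=> Df).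
by rewrite !sumr_const card_ord.
Qed.

(** The positive cone of [R(T)], stated through [tau] alone; [fixed_pos_range] and [range_fixed_pos]
    give the link with the range. *)
Definition fixed_pos r : Prop := D r /\ tau r = r.

Lemma fixed_pos_ge0 r : fixed_pos r -> 0 <= r.
Proof. by case=> /natural_domain_pos_ge0. Qed.

Lemma fixed_pos_ext f : D f -> fixed_pos (tau f).
Proof. exact: (cond_exp_ext_pos_idem hEu hT). Qed.

Lemma fixed_posD r s : fixed_pos r -> fixed_pos s -> fixed_pos (r + s).
Proof.
move=> [Dr rE] [Ds sE]; split; first exact: natural_domain_posD.
by rewrite cond_exp_ext_posDE// rE sE.
Qed.

Lemma fixed_posB r s : fixed_pos r -> fixed_pos s -> s <= r -> fixed_pos (r - s).
Proof.
move=> [Dr rE] fs sr; have s0 := fixed_pos_ge0 fs.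
split; first exact: natural_domain_posB.
by rewrite cond_exp_ext_posB// rE fs.2.
Qed.

Lemma fixed_pos_mulrn r n : fixed_pos r -> fixed_pos (r *+ n).
Proof.
by move=> [Dr rE]; have [Drn rnE] := cond_exp_ext_pos_mulrn n Dr; split; rewrite ?rnE ?rE.
Qed.

Lemma fixed_pos_iota x : 0 <= x -> T x = x -> fixed_pos (iota x).
Proof.
move=> x0 Tx; have [Dx xE] := cond_exp_ext_pos_iota hEu hT x0.
by split; rewrite ?xE ?Tx.
Qed.

(** Monotonicity gives [r \vee s <= tau (r \vee s)]. By idempotence [tau] kills the difference, and
    strict positivity makes it zero. *)
Lemma fixed_pos_join r s : fixed_pos r -> fixed_pos s -> fixed_pos (r \vee s).
Proof.
move=> fr fs; have r0 := fixed_pos_ge0 fr; have s0 := fixed_pos_ge0 fs.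
have rs0 : 0 <= r \vee s := le_trans r0 (riesz_leUl _ _).
have Drs : D (r \vee s).
  apply: natural_domain_posS (fixed_posD fr fs).1 rs0 _.
  by apply: riesz_join_le; rewrite ?riesz_ler_wpDr ?riesz_ler_wpDl.
split=> //; have [Dt tt] := fixed_pos_ext Drs.
have le : r \vee s <= tau (r \vee s).
  apply: riesz_join_le.
    by rewrite -{1}fr.2; exact: cond_exp_ext_pos_mono Drs r0 (riesz_leUl _ _).
  by rewrite -{1}fs.2; exact: cond_exp_ext_pos_mono Drs s0 (riesz_leUr _ _).
apply/eqP; rewrite -subr_eq0; apply/eqP.
apply: (cond_exp_ext_pos_strict hEu hT hpos); first exact: natural_domain_posB.
by rewrite cond_exp_ext_posB// tt subrr.
Qed.

Lemma fixed_pos_meet r s : fixed_pos r -> fixed_pos s -> fixed_pos (r \wedge s).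
Proof.
move=> fr fs; have r0 := fixed_pos_ge0 fr; have s0 := fixed_pos_ge0 fs.
rewrite riesz_meetE; apply: fixed_posB; [exact: fixed_posD|exact: fixed_pos_join|].
by apply: riesz_join_le; rewrite ?riesz_ler_wpDr ?riesz_ler_wpDl.
Qed.

Lemma fixed_pos_pos r s : fixed_pos r -> fixed_pos s -> fixed_pos (riesz_pos (r - s)).
Proof.
move=> fr fs; have -> : riesz_pos (r - s) = r - (r \wedge s).
  by rewrite -{2}(riesz_posE r s) [RHS]addrC addKr.
by apply: fixed_posB => //; [exact: fixed_pos_meet|exact: riesz_leIl].
Qed.

Lemma fixed_pos_sup (y : nat -> Eu) m b : (forall n, y n <= y n.+1) ->
  (forall n, fixed_pos (y n)) -> is_sup y m -> D b -> m <= b -> fixed_pos m.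
Proof.
move=> yS fy ym Db mb.
have Dm : D m.
  apply: natural_domain_posS Db _ mb.
  exact: le_trans (fixed_pos_ge0 (fy 0%N)) (ym.1 0%N).
split=> //; apply/le_anti/andP; split.
  have [] // := cond_exp_ext_pos_monotone_cvg hEu hT yS (fun n => (fy n).1) ym (b := m).
  by move=> n; rewrite (fy n).2; exact: ym.1.
apply: ym.2 => n; rewrite -(fy n).2; apply: cond_exp_ext_pos_mono Dm _ (ym.1 n).
exact: fixed_pos_ge0.
Qed.

Lemma fixed_pos_inf (y : nat -> Eu) m : (forall n, y n.+1 <= y n) ->
  (forall n, fixed_pos (y n)) -> is_inf y m -> fixed_pos m.
Proof.
move=> yS fy ym.
have yle n : y n <= y 0%N := riesz_nonincreasing yS (leq0n n).
have m0 : 0 <= m by apply: ym.2 => n; exact: fixed_pos_ge0.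
have f0m : fixed_pos (y 0%N - m).
  apply: (@fixed_pos_sup (fun n => y 0%N - y n) _ (y 0%N)).
  - by move=> n; rewrite riesz_le_add2l riesz_le_opp2.
  - by move=> n; exact: fixed_posB.
  - exact: is_inf_BlDl.
  - exact: (fy 0%N).1.
  - by rewrite riesz_leBlDr riesz_ler_wpDr.
rewrite -(subKr (y 0%N) m); apply: fixed_posB => //.
by rewrite riesz_leBlDr riesz_ler_wpDr.
Qed.

Lemma natural_domainP f : natural_domain iota T f <-> D (abs f).
Proof.
split=> [[g [h [Dg Dh ->]]]|Df].
  have g0 := natural_domain_pos_ge0 Dg; have h0 := natural_domain_pos_ge0 Dh.
  apply: natural_domain_posS (natural_domain_posD Dg Dh) (riesz_abs_ge0 _) _.
  by apply: (le_trans (riesz_absD _ _)); rewrite riesz_absN !riesz_abs_id.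
exists (riesz_pos f), (riesz_pos (- f)); rewrite riesz_posBN; split=> //.
  exact: natural_domain_posS Df (riesz_pos_ge0 _) (riesz_pos_le_abs _).
apply: natural_domain_posS Df (riesz_pos_ge0 _) _.
by rewrite -riesz_absN; exact: riesz_pos_le_abs.
Qed.

Lemma cond_exp_extB g h : D g -> D h ->
  cond_exp_ext iota T (g - h) = tau g - tau h.
Proof.
move=> Dg Dh; apply: xget_unique; first by exists g, h.
move=> _ [g' [h' [Dg' Dh' gh ->]]].
have /(congr1 tau) : g' + h = g + h'.
  by rewrite -(subrK h g) gh addrAC subrK.
rewrite !cond_exp_ext_posDE// => H.
by apply/eqP; rewrite subr_eq addrAC -H addrK.
Qed.

Lemma cond_exp_ext_posE f : D f -> cond_exp_ext iota T f = tau f.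
Proof.
move=> Df; rewrite -{1}[f]subr0 cond_exp_extB//; last exact: natural_domain_pos0.
by rewrite (cond_exp_ext_pos0 hEu hT) subr0.
Qed.

Lemma norm_T1E f : D (abs f) -> norm_T1 iota T f = tau (abs f).
Proof. exact: cond_exp_ext_posE. Qed.

Lemma fixed_pos_range r : fixed_pos r -> cond_exp_range iota T r.
Proof.
move=> [Dr rE]; exists r; last by rewrite cond_exp_ext_posE.
by apply/natural_domainP; rewrite riesz_abs_id//; exact: natural_domain_pos_ge0 Dr.
Qed.

Lemma range_fixed_pos r : 0 <= r -> cond_exp_range iota T r -> fixed_pos r.
Proof.
move=> r0 [_ [g [h [Dg Dh ->]]] ]; rewrite cond_exp_extB// => rE.
have fg := fixed_pos_ext Dg; have fh := fixed_pos_ext Dh.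
by rewrite -rE; apply: fixed_posB => //; rewrite -riesz_subr_ge0 rE.
Qed.

Lemma cond_exp_ext_pos_dist f g h : D (abs (f - h)) -> D (abs (h - g)) ->
  D (abs (f - g)) /\
  tau (abs (f - g)) <= tau (abs (f - h)) + tau (abs (h - g)).
Proof.
move=> Dfh Dhg; have Ds := natural_domain_posD Dfh Dhg.
have le := riesz_dist_triangle h f g; have a0 := riesz_abs_ge0 (f - g).
split; first exact: natural_domain_posS Ds a0 le.
by rewrite -cond_exp_ext_posDE//; exact: cond_exp_ext_pos_mono.
Qed.

Lemma natural_domain_pos_dist f g : D f -> D g -> D (abs (f - g)).
Proof. by move=> Df Dg; apply/natural_domainP; exists f, g. Qed.

Section Complete.
Variable e : Eu.
Hypotheses (he : disjointness_unit e) (De : D e).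

Lemma riesz_le_scale_inv u f k : f *+ k.+1 <= u -> f <= k.+1%:R^-1 *: u.
Proof.
rewrite -scaler_nat => /(riesz_le_scale (a := k.+1%:R^-1)).
rewrite scalerA mulVf ?pnatr_eq0// scale1r; apply.
by rewrite invr_ge0 ler0n.
Qed.

(* A lower bound [m] of the [q k], the components of [e] on which
   [sup_n y n > k *: e], satisfies [k *: T m <= u] for all [k]. *)
Lemma cond_exp_ext_pos_complete (y : nat -> Eu) u :
  (forall n, y n <= y n.+1) -> (forall n, D (y n)) ->
  (forall n, tau (y n) <= u) ->
  exists m, [/\ is_sup y m, D m & tau m <= u].
Proof.
move=> yS Dy yu; have hX := completion_dedekind hEu; have e0 := he.1.
have y0 n := natural_domain_pos_ge0 (Dy n).
pose z k n := e \wedge (riesz_pos (y n - e *+ k) *+ n.+1).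
have z0 k n : 0 <= z k n.
  by apply: riesz_meet_ge0 => //; exact: riesz_ge0_mulrn (riesz_pos_ge0 _).
have ze k n : z k n <= e by exact: riesz_leIl.
have zS k n : z k n <= z k n.+1.
  apply: riesz_leI2 => //; apply: (@le_trans _ _ (riesz_pos (y n.+1 - e *+ k) *+ n.+1)).
    by apply: riesz_le_mulrn; apply: riesz_pos_mono; rewrite riesz_le_add2r.
  by apply: riesz_le_mulrn2 => //; exact: riesz_pos_ge0.
have [q qsup] := choice (fun k => sup_exists hX 0%N (ze k)).
have q0 k : 0 <= q k by exact: le_trans (z0 k 0%N) ((qsup k).1 0%N).
have [m mq] := inf_exists hX 0%N q0.
have m0 : 0 <= m by apply: mq.2.
have Dm : D m.
  apply: natural_domain_posS De m0 _; apply: le_trans (mq.1 0%N) _.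
  exact: (qsup 0%N).2.
have Dz k n : D (z k n) := natural_domain_posS De (z0 k n) (ze k n).
(* Markov's inequality bounds [tau (z k.+1 n) *+ k.+1] by [tau (y n)], and monotone convergence
   carries the bound to [q k.+1]. The index starts at one to allow division. *)
have qu k : tau (q k.+1) <= k.+1%:R^-1 *: u.
  apply: (cond_exp_ext_pos_monotone_cvg hEu hT (zS k.+1) (Dz k.+1) (qsup k.+1) _).2.
  move=> n; apply: riesz_le_scale_inv; have [_ <-] := cond_exp_ext_pos_mulrn k.+1 (Dz k.+1 n).
  apply: le_trans (yu n); apply: cond_exp_ext_pos_mono (Dy n) _ _.
    exact: riesz_ge0_mulrn.
  have := @riesz_markov _ _ e (y n) k.+1%:R n.+1.
  by rewrite !scaler_nat; apply.
have m_eq0 : m = 0.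
  apply: (cond_exp_ext_pos_strict hEu hT hpos) => //.
  apply/le_anti/andP; split; last exact: cond_exp_ext_pos_ge0.
  apply: (riesz_archimedean hX (x := u)) => -[|k].
    by rewrite mulr0n; apply: le_trans (yu 0%N); exact: cond_exp_ext_pos_ge0.
  have Dq : D (q k.+1) by apply: natural_domain_posS De (q0 _) _; exact: (qsup _).2.
  rewrite -scaler_nat; have := le_trans (cond_exp_ext_pos_mono Dq m0 (mq.1 _)) (qu k).
  move=> /(riesz_le_scale (a := k.+1%:R)); rewrite scalerA mulfV ?pnatr_eq0// scale1r.
  by apply; rewrite ler0n.
rewrite m_eq0 in mq.
have hlat : laterally_complete Eu by case: hEu => -[].
have [b yb] := laterally_complete_bound hX hlat he yS qsup mq.
have [f yf] := sup_exists hX 0%N yb.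
have [Df fu] := cond_exp_ext_pos_monotone_cvg hEu hT yS Dy yf yu.
by exists f.
Qed.

End Complete.

End FixedPoints.

(** * Stopping a positive strong Cauchy sequence at a given tolerance *)

Section StoppedSequence.
Context {R : realType} {E Eu : rieszSpaceType R}.
Context {iota : {linear E -> Eu}} {T : {linear E -> E}}.
Hypotheses (hEu : universal_completion iota) (hT : cond_expectation T).
Hypothesis hpos : strictly_positive T.

Local Notation D := (natural_domain_pos iota T).
Local Notation tau := (cond_exp_ext_pos iota T).
Local Notation fixed := (@fixed_pos R E Eu iota T).
Local Notation abs := riesz_abs.

Lemma iota_disjointness_unit (x : E) :
  disjointness_unit x -> disjointness_unit (iota x).
Proof.
move=> [x0 xu]; split; first by rewrite iota_ge0.
move=> t t0 tx; apply/eqP/contraT => tn0.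
have : 0 < t by rewrite lt_neqAle eq_sym tn0.
move=> /(completion_dense hEu)[y [y0 yt]].
suff yE : y = 0 by move: y0; rewrite yE ltxx.
apply: xu; first exact: ltW.
have := riesz_disj_mono _ _ yt (lexx (iota x)) tx.
rewrite -(iota_meet hEu) => H; have [_ inj _ _] := hEu; apply: inj.
by rewrite linear0; apply: H; rewrite iota_ge0// ltW.
Qed.

(** For disjoint [F i] the truncations add up to the truncation of [u] at the sum. *)
Lemma sum_meet_le (u : Eu) (F : nat -> Eu) n : 0 <= u -> (forall i, 0 <= F i) ->
  (forall i j, i != j -> F i \wedge F j = 0) -> \sum_(i < n) (u \wedge F i) <= u.
Proof.
move=> u0 F0 Fd.
suff -> : \sum_(i < n) (u \wedge F i) = u \wedge (\sum_(i < n) F i).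
  exact: riesz_leIl.
elim: n => [|n IHn].
  by rewrite !big_ord0 riesz_meetC; apply/esym/riesz_meet_idPl.
rewrite !big_ord_recr IHn /= riesz_meetDE//; first exact: riesz_sum_ge0.
rewrite riesz_meetC.
suff [] : 0 <= \sum_(i < n) F i /\ F n \wedge (\sum_(i < n) F i) = 0 by [].
elim/big_ind: _ => [|y z [y0 yn] [z0 zn]|i _].
- by split=> //; rewrite riesz_meetC; apply/riesz_meet_idPl.
- by split; [exact: riesz_addr_ge0|exact: riesz_disjD].
- by split=> //; apply: Fd; rewrite neq_ltn ltn_ord orbT.
Qed.

Lemma meet_sum_le (u : Eu) (F : nat -> Eu) n : 0 <= u -> (forall i, 0 <= F i) ->
  u \wedge (\sum_(i < n) F i) <= \sum_(i < n) (u \wedge F i).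
Proof.
move=> u0 F0; elim: n => [|n IHn]; first by rewrite !big_ord0 riesz_leIr.
rewrite !big_ord_recr /=; apply: le_trans (riesz_meet_leD _ _ _) _ => //.
  exact: riesz_sum_ge0.
by rewrite riesz_le_add2r.
Qed.

Lemma riesz_le_sum n (F G : 'I_n -> Eu) : (forall i, F i <= G i) ->
  \sum_(i < n) F i <= \sum_(i < n) G i.
Proof. by move=> FG; elim/big_ind2: _ => // *; exact: riesz_leD. Qed.

(** Meant for the glued sums: apart from its [k]-th term, which is below [f k], such a sum is
    bounded by multiples of pieces disjoint from the [k]-th one. *)
Lemma riesz_sum_le_split (F G : nat -> Eu) (u : Eu) k n : 0 <= u -> F k <= u ->
  (forall i, F i <= G i) ->
  \sum_(i < n) F i <= u + \sum_(i < n | i != k :> nat) G i.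
Proof.
move=> u0 Fu FG.
rewrite [X in _ + X]big_mkcond /=.
(* The term [u] enters only once the index [k] has been passed, so that the induction spends it a
   single time. *)
suff : \sum_(i < n) F i <=
    (if (k < n)%N then u else 0) + \sum_(i < n) (if i != k :> nat then G i else 0).
  by move=> /le_trans; apply; rewrite riesz_le_add2r; case: ifP.
elim: n => [|n IHn]; first by rewrite !big_ord0 add0r.
rewrite !big_ord_recr /= addrA ltnS; have [nk|nk] := eqVneq n k.
  move: IHn; rewrite nk leqnn ltnn add0r addr0 => IHn.
  by rewrite [leRHS]addrC; exact: riesz_leD.
have -> : (k <= n)%N = (k < n)%N by rewrite ltn_neqAle eq_sym nk.
exact: riesz_leD.
Qed.

Lemma riesz_term_le_sum (F : nat -> Eu) k n : (forall i, 0 <= F i) ->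
  (k < n)%N -> F k <= \sum_(i < n) F i.
Proof.
move=> F0; elim: n => // n IHn; rewrite big_ord_recr ltnS leq_eqVlt /=.
case/predU1P => [->|/IHn kn]; first by rewrite riesz_ler_wpDl// riesz_sum_ge0.
exact: le_trans kn (riesz_ler_wpDr _ _).
Qed.

Variable e : Eu.
Hypotheses (he : disjointness_unit e).
Hypothesis fe : forall a : R, 0 <= a -> fixed (a *: e).

Let fe1 : fixed e.
Proof. by rewrite -[e]scale1r; apply: fe. Qed.

Section Stopping.
Variables (f v : nat -> Eu) (eps : R).
Hypothesis eps0 : 0 < eps.
Hypotheses (f0 : forall n, D (f n)) (fv : forall n, fixed (v n)).
Hypotheses (vd : forall n, v n.+1 <= v n) (vinf : is_inf v 0).
Hypothesis fcauchy :
  forall n i j, (n <= i)%N -> (n <= j)%N -> tau (abs (f i - f j)) <= v n.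

Let v0 n : 0 <= v n := vinf.1 n.

Let hX := completion_dedekind hEu.

(** [q n] is the component of [e] on which [v n] exceeds [eps *: e]. It decreases with [v n], and
    its differences are the pieces. The third clause bounds the projection of [v n] onto the band of
    [p n]. *)
Lemma stopping_pieces : exists p : nat -> Eu,
  [/\ forall n, fixed (p n),
      forall i j, i != j -> p i \wedge p j = 0,
      forall n k, v n \wedge (p n *+ k) <= eps *: e
    & forall t, 0 <= t -> (forall n, t \wedge p n = 0) -> t = 0].
Proof.
have e0 := he.1; have fee := fe (ltW eps0).
pose w n := riesz_pos (v n - eps *: e).
have w0 n : 0 <= w n := riesz_pos_ge0 _.
have fw n : fixed (w n) by exact: fixed_pos_pos.
pose z n k := e \wedge (w n *+ k.+1).
have fz n k : fixed (z n k) by apply: fixed_pos_meet => //; exact: fixed_pos_mulrn.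
have zS n k : z n k <= z n k.+1.
  by apply: riesz_leI2 => //; apply: riesz_le_mulrn2.
have [q qsup] := choice (fun n => sup_exists hX 0%N (fun k => riesz_leIl e (w n *+ k.+1))).
have qcomp n := component_sup hX e0 (fun=> w0 n) (fun=> lexx (w n)) (qsup n).
have q0 n : 0 <= q n by case: (qcomp n).
have qe n : q n <= e by case: (qcomp n).
have qc n : (e - q n) \wedge q n = 0 by case: (qcomp n).
have qw n : (e - q n) \wedge w n = 0 by case: (qcomp n) => _ _ /(_ 0%N).
have qd n : q n.+1 <= q n.
  apply: (qsup n.+1).2 => k; apply: le_trans ((qsup n).1 k).
  apply: riesz_leI2 => //; apply: riesz_le_mulrn; apply: riesz_pos_mono.
  by rewrite riesz_le_add2r.
have fq n : fixed (q n) by exact: (fixed_pos_sup hEu hT (zS n) (fz n) (qsup n) fe1.1 (qe n)).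
(* Markov's inequality gives [eps *: q n <= v n], so a lower bound of the [q n], scaled by [eps], is
   one of the [v n]. *)
have qinf : is_inf q 0.
  split=> // u uq; suff : eps *: u <= 0.
    move=> /(riesz_le_scale (a := eps^-1)); rewrite scalerA mulVf ?gt_eqF//.
    by rewrite scale1r scaler0; apply; rewrite invr_ge0 ltW.
  apply: vinf.2 => n; have : u <= eps^-1 *: v n.
    apply: le_trans (uq n) _; apply: (qsup n).2 => k.
    have := riesz_markov k.+1 (ltW eps0) e0 (v0 n).
    move=> /(riesz_le_scale (a := eps^-1)); rewrite scalerA mulVf ?gt_eqF//.
    by rewrite scale1r; apply; rewrite invr_ge0 ltW.
  move=> /(riesz_le_scale (ltW eps0)); rewrite scalerA mulfV ?gt_eqF//.
  by rewrite scale1r.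
have p0 n := piece_ge0 qe qd n.
exists (piece e q); split.
- by case=> [|n]; apply: fixed_posB.
- exact: piece_disj.
- move=> n k; have epn : 0 <= eps *: e := fixed_pos_ge0 fee.
  (* [v n <= eps *: e + w n], and [w n] is disjoint from [e - q n], which contains the piece. *)
  apply: (@le_trans _ _ ((piece e q n *+ k) \wedge (eps *: e + w n))).
    rewrite riesz_meetC; apply: riesz_leI2 => //.
    by rewrite addrC -riesz_leBlDr; exact: riesz_le_pos.
  apply: le_trans (riesz_meet_leD _ _ _) _ => //; first exact: riesz_ge0_mulrn.
  rewrite [X in _ + X](_ : _ = 0) ?addr0; first exact: riesz_leIr.
  rewrite riesz_meetC; apply: riesz_disj_mulrn => //; rewrite riesz_meetC.
  by apply: riesz_disj_mono (qw n) => //; exact: piece_le.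
- exact: (disj_pieces he).
Qed.

Let tau_meet_le x r : D x -> fixed r -> tau (x \wedge r) <= tau x \wedge r.
Proof.
move=> Dx fr; have x0 := natural_domain_pos_ge0 Dx; have r0 := fixed_pos_ge0 fr.
have xr0 := riesz_meet_ge0 x0 r0; apply: riesz_meet_ge.
  exact: cond_exp_ext_pos_mono (riesz_leIl _ _).
rewrite -{2}fr.2; exact: cond_exp_ext_pos_mono hT _ _ fr.1 xr0 (riesz_leIr _ _).
Qed.

(* [h] is the sequence stopped at the first [n] with [v n <= eps *: e]: it
   agrees with [f n] on the part [p n] of [e] where this index is [n]. *)
Lemma stopped_sequence : exists h, D h /\
  forall m, tau (abs (f m - h)) <= v m + eps *: e.
Proof.
have [p [fp pd vp pe]] := stopping_pieces.
have e0 := he.1; have epn : 0 <= eps *: e := fixed_pos_ge0 (fe (ltW eps0)).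
have p0 n : 0 <= p n := fixed_pos_ge0 (fp n).
have pk0 n k : 0 <= p n *+ k := riesz_ge0_mulrn k (p0 n).
have fpk n k : fixed (p n *+ k) by exact: fixed_pos_mulrn.
have fn0 n : 0 <= f n := natural_domain_pos_ge0 (f0 n).
have pkd i j k : i != j -> (p i *+ k) \wedge (p j *+ k) = 0.
  move=> ij; apply: riesz_disj_mulrn => //; rewrite riesz_meetC.
  by apply: riesz_disj_mulrn => //; apply: pd; rewrite eq_sym.
(* One index [N] lets both the number of pieces and the height of the truncations grow; the limit of
   [H N] glues the [f n]. *)
pose F N n := f n \wedge (p n *+ N); pose H N := \sum_(n < N) F N n.
have F0 N n : 0 <= F N n by exact: riesz_meet_ge0.
have FD N n : D (F N n) := natural_domain_posS hEu hT (f0 n) (F0 N n) (riesz_leIl _ _).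
have HS N : H N <= H N.+1.
  rewrite /H big_ord_recr /=; apply: (@le_trans _ _ (\sum_(n < N) F N.+1 n)).
    by apply: riesz_le_sum => n; apply: riesz_leI2 => //; exact: riesz_le_mulrn2.
  exact: riesz_ler_wpDr.
have HD N : D (H N) /\ tau (H N) = \sum_(n < N) tau (F N n).
  exact: (cond_exp_ext_pos_sum hEu hT).
have Du : 0 <= tau (f 0%N) + v 0%N.
  by apply: riesz_addr_ge0 => //; exact: cond_exp_ext_pos_ge0.
(* Every [tau (f n)] is below [tau (f 0) + v 0], and the truncations of this one element by disjoint
   pieces sum to at most itself. *)
have Hu N : tau (H N) <= tau (f 0%N) + v 0%N.
  rewrite (HD N).2; apply: le_trans (sum_meet_le N Du (pk0^~ N) _); last first.
    by move=> i j; exact: pkd.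
  apply: riesz_le_sum => n; apply: le_trans (tau_meet_le (f0 n) (fpk n N)) _.
  apply: riesz_leI2 => //; have Dn := natural_domain_pos_dist hEu hT (f0 n) (f0 0%N).
  apply: (@le_trans _ _ (tau (f 0%N + abs (f n - f 0%N)))).
    apply: cond_exp_ext_pos_mono => //; first exact: natural_domain_posD.
    by rewrite addrC -riesz_leBlDr riesz_le_abs.
  by rewrite cond_exp_ext_posDE// riesz_le_add2l; exact: fcauchy.
have [h [Hh Dh _]] := cond_exp_ext_pos_complete hEu hT hpos he fe1.1 HS (fun N => (HD N).1) Hu.
exists h; split=> // m.
(* On the band of [p n], [h] coincides with [f n]: it is not smaller because it dominates every
   [f n \wedge (p n *+ k)], and not larger because [H N] exceeds [f n] only through the other
   pieces. *)
have hp n : abs (f n - h) \wedge p n = 0.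
  rewrite riesz_meetC; set a := riesz_pos (f n - h); set b := riesz_pos (h - f n).
  have a0 : 0 <= a := riesz_pos_ge0 _; have b0 : 0 <= b := riesz_pos_ge0 _.
  suff ab : p n \wedge (a + b) = 0.
    apply: riesz_disj_mono ab => //; first exact: riesz_abs_ge0.
    by rewrite /b -[h - f n]opprB; exact: riesz_abs_le_pos.
  apply: riesz_disjD => //; first rewrite riesz_meetC.
    apply: (riesz_disj_posB hX) => // k.
    apply: le_trans (Hh.1 (maxn n.+1 k)).
    apply: (@le_trans _ _ (F (maxn n.+1 k) n)).
      by apply: riesz_leI2 => //; apply: riesz_le_mulrn2 => //; exact: leq_maxr.
    by apply: riesz_term_le_sum => //; exact: leq_maxl.
  have bsup : is_sup (fun N => riesz_pos (H N - f n)) b.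
    split=> [N|u uH]; first by apply: riesz_pos_mono; rewrite riesz_le_add2r; exact: Hh.1.
    apply: riesz_pos_le; last exact: le_trans (riesz_pos_ge0 _) (uH 0%N).
    rewrite riesz_leBlDr; apply: Hh.2 => N; rewrite -riesz_leBlDr.
    exact: le_trans (riesz_le_pos _) (uH N).
  apply: (@riesz_disj_sup _ _ _ (range (fun N => riesz_pos (H N - f n)))) => //.
  - by exists (riesz_pos (H 0%N - f n)), 0%N.
  - move=> _ [N _ <-]; split; first exact: riesz_pos_ge0.
    apply: (@riesz_disj_mono _ _ (p n) (\sum_(i < N | i != n :> nat) p i *+ N)) => //.
    + exact: riesz_pos_ge0.
    + apply: riesz_pos_le; last first.
        by elim/big_ind: _ => // y z; exact: riesz_addr_ge0.
      rewrite riesz_leBlDr addrC; apply: (@riesz_sum_le_split (F N) (fun i => p i *+ N)) => //.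
        exact: riesz_leIl.
      by move=> i; exact: riesz_leIr.
    + apply: (@riesz_disj_sum _ _ _ (fun i => p i *+ N) (fun i => i != n)) => // i ni.
      by apply: riesz_disj_mulrn => //; apply: pd; rewrite eq_sym.
  - exact/is_supP.
set x := abs (f m - h).
have x0 : 0 <= x := riesz_abs_ge0 _.
have Dx : D x by exact: natural_domain_pos_dist.
(* These truncations increase to [x] because the pieces exhaust [e]; monotone convergence leaves a
   finite sum to estimate. *)
pose y N := x \wedge (\sum_(n < N) p n *+ N).
have sp0 N : 0 <= \sum_(n < N) p n *+ N by exact: riesz_sum_ge0.
have y0 N : 0 <= y N by exact: riesz_meet_ge0.
have yS N : y N <= y N.+1.
  apply: riesz_leI2 => //; rewrite big_ord_recr /=.
  apply: le_trans (riesz_ler_wpDr _ _) => //.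
  by apply: riesz_le_sum => n; exact: riesz_le_mulrn2.
have Dy N : D (y N) := natural_domain_posS hEu hT Dx (y0 N) (riesz_leIl _ _).
have ysup : is_sup y x.
  split=> [N|s ys]; first exact: riesz_leIl.
  suff r0 : riesz_pos (x - s) = 0.
    by have := riesz_le_pos (x - s); rewrite r0 riesz_leBlDr add0r.
  apply: pe => [|n]; first exact: riesz_pos_ge0.
  apply: (riesz_disj_posB hX) => // k; apply: le_trans (ys (maxn n.+1 k)).
  apply: riesz_leI2 => //; apply: (@le_trans _ _ (p n *+ maxn n.+1 k)).
    by apply: riesz_le_mulrn2 => //; exact: leq_maxr.
  by apply: (@riesz_term_le_sum (fun i => p i *+ maxn n.+1 k)) => //; exact: leq_maxl.
have ve0 : 0 <= v m + eps *: e by exact: riesz_addr_ge0.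
apply: (cond_exp_ext_pos_monotone_cvg hEu hT yS Dy ysup _).2 => N.
have Df n := natural_domain_pos_dist hEu hT (f0 m) (f0 n).
have G0 n : 0 <= abs (f m - f n) \wedge (p n *+ N).
  by apply: riesz_meet_ge0 => //; exact: riesz_abs_ge0.
have DG n : D (abs (f m - f n) \wedge (p n *+ N)) :=
  natural_domain_posS hEu hT (Df n) (G0 n) (riesz_leIl _ _).
have [DGs tGs] := cond_exp_ext_pos_sum hEu hT N DG.
apply: (@le_trans _ _ (tau (\sum_(n < N) (abs (f m - f n) \wedge (p n *+ N))))).
  apply: cond_exp_ext_pos_mono => //.
  apply: le_trans (meet_sum_le N x0 (pk0^~ N)) _.
  apply: riesz_le_sum => n.
  (* Under the truncation by [p n *+ N], [h] may be replaced by [f n], since [abs (f n - h)] is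
     disjoint from [p n]. *)
  have fh0 := riesz_abs_ge0 (f n - h); have fm0 := riesz_abs_ge0 (f m - f n).
  rewrite -[leRHS]addr0.
  have <- : (p n *+ N) \wedge abs (f n - h) = 0.
    by rewrite riesz_meetC; apply: riesz_disj_mulrn.
  rewrite [X in _ <= X + _]riesz_meetC riesz_meetC.
  apply: le_trans (riesz_meet_leD _ _ _) => //.
  by apply: riesz_leI2 => //; exact: riesz_dist_triangle.
rewrite tGs; apply: le_trans (sum_meet_le N ve0 (pk0^~ N) _); last first.
  by move=> i j; exact: pkd.
apply: riesz_le_sum => n; apply: le_trans (tau_meet_le (Df n) (fpk n N)) _.
apply: riesz_meet_ge; last exact: riesz_leIr.
(* If the stopping index [n] is at most [m], the distance is controlled by [v n], which is below
   [eps *: e] on the piece; if it is later, by [v m]. *)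
have [nm|mn] := leqP n m.
  apply: le_trans (riesz_ler_wpDl _ (v0 m)); apply: le_trans (vp n N).
  by apply: riesz_leI2 => //; exact: fcauchy.
apply: le_trans (riesz_leIl _ _) _; apply: le_trans (riesz_ler_wpDr _ epn).
by apply: fcauchy => //; exact: ltnW.
Qed.

End Stopping.

End StoppedSequence.

(** * Limits of positive sequences, and order convergence within the range *)

Section StrongCompleteness.
Context {R : realType} {E Eu : rieszSpaceType R}.
Context {iota : {linear E -> Eu}} {T : {linear E -> E}}.
Hypotheses (hEu : universal_completion iota) (hT : cond_expectation T).
Hypothesis hpos : strictly_positive T.

Local Notation D := (natural_domain_pos iota T).
Local Notation tau := (cond_exp_ext_pos iota T).
Local Notation fixed := (@fixed_pos R E Eu iota T).
Local Notation abs := riesz_abs.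

Let hX := completion_dedekind hEu.

Section PositiveSequence.
Variable e : Eu.
Hypotheses (he : disjointness_unit e).
Hypothesis fe : forall a : R, 0 <= a -> fixed (a *: e).

Let fe1 : fixed e.
Proof. by rewrite -[e]scale1r; apply: fe. Qed.

Let eps k : R := 2^-1 ^+ k.

Let eps_gt0 k : 0 < eps k.
Proof. by rewrite exprn_gt0// invr_gt0 ltr0n. Qed.

Let c k : Eu := eps k *: e.

Let c_ge0 k : 0 <= c k := fixed_pos_ge0 (fe (ltW (eps_gt0 k))).

Let c_double k : c k.+1 *+ 2 = c k.
Proof.
rewrite /c -scaler_nat scalerA /eps exprS mulrA mulfV ?mul1r//.
by rewrite pnatr_eq0.
Qed.

Lemma geometric_series (d : nat -> Eu) : (forall k, D (d k)) ->
  (forall k, tau (d k) <= c k *+ 2) ->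
  exists A, D A /\ forall k, \sum_(i < k) d i <= A /\
    tau (A - \sum_(i < k) d i) <= c k *+ 4.
Proof.
move=> Dd td; pose s k := \sum_(i < k) d i.
have sE k : s k.+1 = s k + d k by rewrite /s big_ord_recr.
have Ds k : D (s k) := (cond_exp_ext_pos_sum hEu hT k Dd).1.
have sS k : s k <= s k.+1.
  by rewrite sE riesz_ler_wpDr//; exact: natural_domain_pos_ge0 (Dd k).
have tail k n : tau (s (n + k)%N) <= tau (s k) + c k *+ 4.
  (* The induction carries the unspent tail [c (n + k) *+ 4]; a step costs [c *+ 2] and halving the
     tail releases exactly that. *)
  apply: (@le_trans _ _ (tau (s (n + k)%N) + c (n + k)%N *+ 4)).
    by rewrite riesz_ler_wpDr// riesz_ge0_mulrn.
  elim: n => // n; apply: le_trans; rewrite addSn sE (cond_exp_ext_posDE hEu hT)//.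
  rewrite -addrA riesz_le_add2l (mulrnA _ 2 2) c_double (mulrnDr _ 2 2).
  by rewrite riesz_le_add2r.
have [|A [sA DA _]] := cond_exp_ext_pos_complete hEu hT hpos he fe1.1 sS Ds (u := tau (s 0%N) + c 0%N *+ 4).
  by move=> n; have := tail 0%N n; rewrite addn0.
exists A; split=> // k; split; first exact: sA.1.
have mono := riesz_nondecreasing sS.
apply: (cond_exp_ext_pos_monotone_cvg hEu hT (y := fun n => s (n + k)%N - s k) _ _ _ _).2.
- by move=> n; rewrite riesz_le_add2r addSn.
- move=> n; apply: natural_domain_posB => //; first exact: natural_domain_pos_ge0 (Ds k).
  by apply: mono; exact: leq_addl.
- apply: is_sup_addr; split=> [n|u su]; first exact: sA.1.
  by apply: sA.2 => n; apply: le_trans (su n); apply: mono; exact: leq_addr.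
- move=> n; rewrite (cond_exp_ext_posB hEu hT)//.
  + by rewrite riesz_leBlDr addrC; exact: tail.
  + exact: natural_domain_pos_ge0 (Ds k).
  + by apply: mono; exact: leq_addl.
Qed.

Lemma positive_strong_limit (f v : nat -> Eu) : (forall n, D (f n)) ->
  (forall n, fixed (v n)) -> (forall n, v n.+1 <= v n) -> is_inf v 0 ->
  (forall n i j, (n <= i)%N -> (n <= j)%N -> tau (abs (f i - f j)) <= v n) ->
  exists g, forall n, D (abs (f n - g)) /\ tau (abs (f n - g)) <= v n.
Proof.
move=> Df fv vd vinf fcauchy.
have [h hP] := choice (fun k =>
  stopped_sequence hEu hT hpos he fe (eps_gt0 k) Df fv vd vinf fcauchy).
have Dh k : D (h k) := (hP k).1.
have fh k m : tau (abs (f m - h k)) <= v m + c k := (hP k).2 m.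
have vmono := riesz_nonincreasing vd.
have hh k l : tau (abs (h k - h l)) <= c k + c l.
  have D1 m : D (abs (h k - f m)) by exact: natural_domain_pos_dist.
  have D2 m : D (abs (f m - h l)) by exact: natural_domain_pos_dist.
  (* Passing through [f m] costs [v m] twice. The infimum property removes one copy at a time, with
     separate indices that are compared at their maximum. *)
  have H m : tau (abs (h k - h l)) - (c k + c l) - v m <= v m.
    rewrite !riesz_leBlDr.
    apply: le_trans (cond_exp_ext_pos_dist hEu hT (D1 m) (D2 m)).2 _.
    by rewrite addrACA riesz_distC; apply: riesz_leD; exact: fh.
  rewrite -[leRHS]add0r -riesz_leBlDr; apply: vinf.2 => m.
  rewrite -[leRHS]add0r -riesz_leBlDr; apply: vinf.2 => n.
  apply: (@le_trans _ _ (v (maxn m n))); last by apply: vmono; exact: leq_maxr.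
  apply: le_trans (H (maxn m n)); rewrite riesz_le_add2l riesz_le_opp2.
  by apply: vmono; exact: leq_maxl.
have hS k : tau (abs (h k.+1 - h k)) <= c k *+ 2.
  apply: le_trans (hh k.+1 k) _; rewrite mulr2n riesz_le_add2r -(c_double k) mulr2n.
  exact: riesz_ler_wpDr.
have Dhh k l : D (abs (h k - h l)) by exact: natural_domain_pos_dist.
have posP k l : D (riesz_pos (h k - h l)) /\
    tau (riesz_pos (h k - h l)) <= tau (abs (h k - h l)).
  by apply: (natural_domain_pos_solid hEu hT) => //;
    [exact: riesz_pos_ge0|exact: riesz_pos_le_abs].
pose d1 k := riesz_pos (h k.+1 - h k); pose d2 k := riesz_pos (h k - h k.+1).
have [A [DA AP]] : exists A, D A /\ forall k, \sum_(i < k) d1 i <= A /\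
    tau (A - \sum_(i < k) d1 i) <= c k *+ 4.
  apply: geometric_series => k; first exact: (posP _ _).1.
  exact: le_trans (posP _ _).2 (hS k).
have [B [DB BP]] : exists B, D B /\ forall k, \sum_(i < k) d2 i <= B /\
    tau (B - \sum_(i < k) d2 i) <= c k *+ 4.
  apply: geometric_series => k; first exact: (posP _ _).1.
  by apply: le_trans (posP _ _).2 _; rewrite riesz_distC.
have hE k : h k = h 0%N + (\sum_(i < k) d1 i - \sum_(i < k) d2 i).
  elim: k => [|k IHk]; first by rewrite !big_ord0 subrr addr0.
  rewrite !big_ord_recr /= opprD [X in _ + X]addrACA (addrA (h 0%N)) -IHk /d1 /d2.
  by rewrite -[h k - h k.+1]opprB riesz_posBN addrC subrK.
exists (h 0%N + (A - B)) => n; set g := h 0%N + (A - B).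
have hg k : D (abs (h k - g)) /\ tau (abs (h k - g)) <= c k *+ 8.
  set a := A - \sum_(i < k) d1 i; set b := B - \sum_(i < k) d2 i.
  have d1s0 : 0 <= \sum_(i < k) d1 i by apply: riesz_sum_ge0 => i; exact: riesz_pos_ge0.
  have d2s0 : 0 <= \sum_(i < k) d2 i by apply: riesz_sum_ge0 => i; exact: riesz_pos_ge0.
  have Da : D a by apply: natural_domain_posB => //; exact: (AP k).1.
  have Db : D b by apply: natural_domain_posB => //; exact: (BP k).1.
  have Dab := natural_domain_posD hEu hT Da Db.
  have le : abs (h k - g) <= a + b.
    have -> : h k - g = b - a.
      rewrite hE /g opprD addrACA subrr add0r /a /b !opprB addrACA.
      by rewrite [in RHS]addrACA [- \sum_(i < k) d2 i + _]addrC; congr (_ + _); rewrite addrC.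
    apply: le_trans (riesz_absD _ _) _; rewrite riesz_absN.
    by rewrite !riesz_abs_id 1?addrC//; apply: natural_domain_pos_ge0; eassumption.
  have [Dg tg] := natural_domain_pos_solid hEu hT Dab (riesz_abs_ge0 _) le.
  split=> //; apply: le_trans tg _; rewrite (cond_exp_ext_posDE hEu hT)//.
  by rewrite (mulrnDr _ 4 4); apply: riesz_leD; [exact: (AP k).2|exact: (BP k).2].
have Dfh k m : D (abs (f m - h k)) by exact: natural_domain_pos_dist.
have Dfg m : D (abs (f m - g)).
  exact: (cond_exp_ext_pos_dist hEu hT (Dfh 0%N m) (hg 0%N).1).1.
split=> //.
(* The path is [f n], [f p], [h k], [g] with [p] large: it costs [v n], then [v p + c k], then
   [c k *+ 8], whence the factor 9. *)
have key k : tau (abs (f n - g)) - v n <= c k *+ 9.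
  rewrite -[leRHS]add0r -riesz_leBlDr; apply: vinf.2 => m.
  apply: (@le_trans _ _ (v (maxn m n))); last by apply: vmono; exact: leq_maxl.
  set p := maxn m n; rewrite !riesz_leBlDr.
  have Dnp : D (abs (f n - f p)) by exact: natural_domain_pos_dist.
  apply: le_trans (cond_exp_ext_pos_dist hEu hT Dnp (Dfg p)).2 _.
  rewrite [leRHS]addrC; apply: riesz_leD; first by apply: fcauchy => //; exact: leq_maxr.
  apply: le_trans (cond_exp_ext_pos_dist hEu hT (Dfh k p) (hg k).1).2 _.
  rewrite mulrS addrA; apply: riesz_leD; [exact: fh|exact: (hg k).2].
rewrite -riesz_subr_ge0 -riesz_le_opp2 oppr0 opprB.
(* The positive part makes multiples monotone: [x *+ j <= x *+ (2 ^ j)], and [2 ^ j] copies of [c j]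
   make up [e]. *)
apply: le_trans (riesz_le_pos _) _; apply: (riesz_archimedean hX (x := e *+ 9)) => j.
set x := riesz_pos _; have x0 : 0 <= x := riesz_pos_ge0 _.
have xc : x <= c j *+ 9 by apply: riesz_pos_le => //; exact: riesz_ge0_mulrn.
apply: (@le_trans _ _ (x *+ (2 ^ j))).
  by apply: riesz_le_mulrn2 => //; exact/ltnW/ltn_expl.
apply: le_trans (riesz_le_mulrn _ xc) _; rewrite mulrnAC.
suff -> : c j *+ (2 ^ j) = e by [].
elim: j {xc} => [|j IHj]; first by rewrite /c /eps expr0 scale1r.
by rewrite expnS mulrnA c_double.
Qed.

End PositiveSequence.

(** Limits are relative to [R(T)], so suprema of tails must be found there: they are increasing
    limits of finite joins of fixed elements, dominated by a [w n]. The infima of the tails are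
    [0]. *)
Lemma order_cvg_range (x w : nat -> Eu) n0 : (forall n, fixed (x n)) ->
  (forall n, fixed (w n)) -> (forall n, w n.+1 <= w n) -> is_inf w 0 ->
  (forall n, x (n0 + n)%N <= w n) ->
  order_cvg_in (cond_exp_range iota T) (fun m n : nat => (m <= n)%N) x 0.
Proof.
move=> fx fw wd winf xw.
have x0 n := fixed_pos_ge0 (fx n).
have R0 : cond_exp_range iota T 0.
  apply: (fixed_pos_range hEu hT); split; first exact: natural_domain_pos0.
  exact: (cond_exp_ext_pos0 hEu hT).
have Rfixed r : fixed r -> cond_exp_range iota T r := fixed_pos_range hEu hT (r := r).
have wmono := riesz_nonincreasing wd.
have xw' i j : (n0 <= i)%N -> (i <= j)%N -> x j <= w (i - n0)%N.
  move=> ni ij; rewrite -(subnKC (leq_trans ni ij)); apply: le_trans (xw _) _.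
  by apply: wmono; exact: leq_sub2r.
(* Keeping [n0 <= i] under the existential lets [choice] return a total sequence, with the dummy [0]
   before [n0]. *)
have sup_tail i : exists s, (n0 <= i)%N ->
    sup_in (cond_exp_range iota T) (tail (fun m n : nat => (m <= n)%N) x i) s /\
    0 <= s <= w (i - n0)%N.
  have [ni|] := leqP n0 i; last by exists 0.
  pose y := fix y n := if n is m.+1 then y m \vee x (i + n)%N else x i.
  have fy n : fixed (y n) by elim: n => //= n IHn; exact: fixed_pos_join.
  have yS n : y n <= y n.+1 by exact: riesz_leUl.
  have xy n : x (i + n)%N <= y n.
    by case: n => [|n]; rewrite ?addn0//; exact: riesz_leUr.
  have yle u : (forall j, (i <= j)%N -> x j <= u) -> forall n, y n <= u.
    move=> xu; elim=> [|n IHn]; first exact: xu.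
    by apply: riesz_join_le => //; apply: xu; exact: leq_addr.
  have yw n : y n <= w (i - n0)%N by apply: yle => j; exact: xw'.
  have [s ys] := sup_exists hX 0%N yw.
  have sw : s <= w (i - n0)%N by exact: ys.2.
  have fs : fixed s := fixed_pos_sup hEu hT yS fy ys (fw _).1 sw.
  exists s => _; split; last by rewrite sw andbT (fixed_pos_ge0 fs).
  split; first split; first exact: Rfixed.
    by move=> _ [j ij <-]; rewrite -(subnKC ij); exact: le_trans (xy _) (ys.1 _).
  move=> u [_ tu]; apply: ys.2; apply: yle => j ij; apply: tu; by exists j.
have [s sP] := choice sup_tail.
split.
- by move=> n; exact: Rfixed.
- exists n0; split; [exists (w 0%N)|exists 0]; split=> //; first exact: Rfixed.
    by move=> _ [j nj <-]; rewrite -(subnn n0); exact: xw'.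
  by move=> _ [j _ <-].
- exists n0, s; split; first by move=> i ni; case: (sP i ni).
  split; first split=> // _ [i ni <-]; first by have [_ /andP[]] := sP i ni.
  move=> u [_ us]; apply: winf.2 => n.
  have ni := leq_addr n n0; have [_ /andP[_]] := sP _ ni; rewrite addKn.
  by apply: le_trans; apply: us; exists (n0 + n)%N.
- exists n0, (fun=> 0); split; last first.
    split; first by split=> // _ [i _ <-].
    by move=> u [_ us]; apply: us; exists n0 => //=.
  move=> i _; split; first by split=> // _ [j _ <-].
  move=> u [_ us]; apply: winf.2 => n.
  apply: (@le_trans _ _ (x (n0 + maxn i n)%N)).
    apply: us; exists (n0 + maxn i n)%N => //=.
    exact: leq_trans (leq_maxl i n) (leq_addl _ _).
  by apply: le_trans (xw _) _; apply: wmono; exact: leq_maxr.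
Qed.

End StrongCompleteness.

(** * Reduction to positive sequences *)

Theorem theorem3p1 (R : realType) (E Eu : rieszSpaceType R)
    (iota : {linear E -> Eu}) (T : {linear E -> E})
    (hE : dedekind_complete [set: E])
    (he : exists e : E, weak_order_unit e)
    (hEu : universal_completion iota)
    (hT : cond_expectation T)
    (hpos : strictly_positive T) :
  forall f : nat -> Eu,
    (forall n, natural_domain iota T (f n)) ->
    strong_cauchy iota T f ->
    exists g : Eu, natural_domain iota T g /\
      order_cvg_in (cond_exp_range iota T) (fun m n : nat => (m <= n)%N)
        (fun n => norm_T1 iota T (f n - g)) 0.
Proof.
move=> f Lf [n0 [v [vsup vd [[_ v0] vinf]]]].
have [e0 /(cond_exp_weak_unit hT) ue] := he.
pose e := iota (T e0); have e_ge0 : 0 <= T e0 := ue.1.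
have eu : disjointness_unit e.
  exact: (iota_disjointness_unit hEu) (weak_order_unit_disjointness ue).
have fe (a : R) : 0 <= a -> @fixed_pos R E Eu iota T (a *: e).
  move=> a0; rewrite -linearZ; apply: (fixed_pos_iota hEu hT).
    exact: riesz_scale_ge0.
  by rewrite linearZ /= (cond_exp_proj hT).
have Lpos u : natural_domain iota T u -> natural_domain_pos iota T (riesz_pos u).
  move=> /(natural_domainP hEu hT) Du.
  exact: (natural_domain_posS hEu hT Du) (riesz_pos_ge0 _) (riesz_pos_le_abs _).
have LB u w : natural_domain iota T u -> natural_domain iota T w ->
    natural_domain iota T (u - w).
  move=> [a [b [Da Db ->]]] [a' [b' [Da' Db' ->]]].
  exists (a + b'), (b + a'); split; try exact: natural_domain_posD.
  by rewrite opprB opprD addrACA.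
have LN u : natural_domain iota T u -> natural_domain iota T (- u).
  by rewrite -[- u]sub0r -(subrr (f 0%N)) => Lu; apply: (LB) => //; exact: (LB).
have Dff i j : natural_domain_pos iota T (riesz_abs (f i - f j)).
  by apply/(natural_domainP hEu hT); exact: LB.
pose V n := v (n0 + n)%N.
have fV i j n : (n <= i)%N -> (n <= j)%N ->
    cond_exp_ext_pos iota T (riesz_abs (f (n0 + i)%N - f (n0 + j)%N)) <= V n.
  move=> ni nj; have [[_ ub] _] := vsup _ (leq_addr n n0); apply: ub.
  by exists (n0 + i)%N, (n0 + j)%N; rewrite !leq_add2l norm_T1E.
have fixV n : @fixed_pos R E Eu iota T (V n).
  apply: (range_fixed_pos hEu hT).
    apply: le_trans (fV n n n (leqnn n) (leqnn n)); exact: cond_exp_ext_pos_ge0.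
  by have [[]] := vsup _ (leq_addr n n0).
have VS n : V n.+1 <= V n by apply: vd; rewrite ?leq_addr// leq_add2l.
(* [vinf] is an infimum among elements of the range only. The infimum in [Eu] is fixed by the
   extended operator, hence in the range, and so is at most [0]. *)
have infV : is_inf V 0.
  have V0 n := fixed_pos_ge0 (fixV n).
  have [m Vm] := inf_exists (completion_dedekind hEu) 0%N V0.
  suff m0 : m <= 0 by split=> // u uV; exact: le_trans (Vm.2 u uV) m0.
  apply: vinf; split.
    exact: (fixed_pos_range hEu hT) (fixed_pos_inf hEu hT VS fixV Vm).
  move=> _ [n /= nn <-]; rewrite -(subnKC nn); exact: Vm.1.
have limit (u : nat -> Eu) : (forall n, natural_domain_pos iota T (u n)) ->
    (forall i j, riesz_abs (u i - u j) <= riesz_abs (f i - f j)) ->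
    exists g, forall n,
      natural_domain_pos iota T (riesz_abs (u (n0 + n)%N - g)) /\
      cond_exp_ext_pos iota T (riesz_abs (u (n0 + n)%N - g)) <= V n.
  move=> Du uf.
  apply: (positive_strong_limit hEu hT hpos eu fe (f := fun n => u (n0 + n)%N)) => //.
  move=> n i j ni nj; apply: le_trans (fV _ _ _ ni nj).
  exact: (cond_exp_ext_pos_mono hEu hT) (riesz_abs_ge0 _) (uf _ _).
have [g1 g1P] := limit (fun n => riesz_pos (f n)) (fun n => Lpos _ (Lf n))
  (fun i j => riesz_pos_dist (f i) (f j)).
have [||g2 g2P] := limit (fun n => riesz_pos (- f n)).
- by move=> n; exact/Lpos/LN.
- move=> i j; apply: le_trans (riesz_pos_dist _ _) _.
  by rewrite -opprD riesz_absN.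
pose g := g1 - g2.
have le n : riesz_abs (f n - g) <= riesz_abs (riesz_pos (f n) - g1) +
    riesz_abs (riesz_pos (- f n) - g2).
  rewrite -{1}(riesz_posBN (f n)) /g opprB [g2 - g1]addrC addrACA.
  rewrite [- _ + g2]addrC -[g2 - _]opprB; apply: le_trans (riesz_absD _ _) _.
  by rewrite riesz_absN.
have Lg : natural_domain iota T g.
  have Lfg : natural_domain iota T (f (n0 + 0)%N - g).
    apply/(natural_domainP hEu hT).
    apply: (natural_domain_posS hEu hT) (riesz_abs_ge0 _) (le _).
    exact: (natural_domain_posD hEu hT (g1P 0%N).1 (g2P 0%N).1).
  by have := LB _ _ (Lf (n0 + 0)%N) Lfg; rewrite subKr.
have Dfg n : natural_domain_pos iota T (riesz_abs (f n - g)).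
  by apply/(natural_domainP hEu hT); exact: LB.
(* One copy of [V] for the positive parts and one for the negative parts. *)
exists g; split=> //; apply: (order_cvg_range hEu hT hpos (w := fun n => V n + V n) (n0 := n0)).
- by move=> n; rewrite norm_T1E//; exact: fixed_pos_ext.
- by move=> n; exact: fixed_posD.
- by move=> n; exact: riesz_leD.
- split=> [n|u uV]; first by apply: riesz_addr_ge0; exact: infV.1.
  apply: infV.2 => m; rewrite -[leRHS]add0r -riesz_leBlDr; apply: infV.2 => n.
  have Vmono := riesz_nonincreasing VS.
  rewrite riesz_leBlDr; apply: le_trans (uV (maxn n m)) _.
  by apply: riesz_leD; apply: Vmono; rewrite ?leq_maxl ?leq_maxr.
- move=> n; rewrite norm_T1E//.
  have [D1 t1] := g1P n; have [D2 t2] := g2P n.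
  apply: le_trans (riesz_leD t1 t2).
  rewrite -(cond_exp_ext_posDE hEu hT)//.
  apply: (cond_exp_ext_pos_mono hEu hT) (riesz_abs_ge0 _) (le _).
  exact: natural_domain_posD.
Qed.
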